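(* Let $G$ be a finite, simple, connected planar graph and let $T$ be a spanning tree of $G$. If $T$ is a fundamental Tutte tree of $G$, then in every plane drawing of $G$ all leaves of $T$ lie on (the boundary of) one common face.
   Context: For a spanning tree $T$ of $G$ and an edge $e\in E(G)\setminus E(T)$, the fundamental cycle $C_e$ is the unique cycle in $T+e$. A cycle $C$ of $G$ is nonseparating if $G-C$ (the subgraph induced by $V(G)\setminus V(C)$) is connected; by convention a Hamiltonian cycle is nonseparating. A fundamental Tutte tree of $G$ is a spanning tree $T$ such that every fundamental cycle with respect to $T$ is nonseparating. *)

(* Defs.v *)
From HB Require Import structures.
From mathcomp Require Import all_boot all_order all_algebra.
From mathcomp Require Import all_classical all_reals all_analysis.

Set Implicit Arguments.
Unset Strict Implicit.
Unset Printing Implicit Defensive.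

Import Order.TTheory GRing.Theory Num.Theory.
Import numFieldNormedType.Exports.

Local Open Scope classical_set_scope.
Local Open Scope ring_scope.

(** * Finite graphs, given by their adjacency relation *)

Definition simple_graph (V : finType) (e : rel V) : Prop :=
  symmetric e /\ irreflexive e.

Definition induced (V : finType) (e : rel V) (A : {set V}) : rel V :=
  [rel x y | [&& x \in A, y \in A & e x y]].

(* Connected graphs are nonempty, hence the separate clause for Hamiltonian
   cycles in [nonseparating]. *)
Definition gconnected_on (V : finType) (e : rel V) (A : {set V}) : Prop :=
  (exists x, x \in A) /\ {in A &, forall x y, connect (induced e A) x y}.

Definition gconnected (V : finType) (e : rel V) : Prop :=
  gconnected_on e [set: V]%SET.

(* A cycle is listed as the sequence of its vertices, in cyclic order. *)
Definition graph_cycle (V : finType) (e : rel V) (c : seq V) : bool :=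
  [&& (2 < size c)%N, uniq c & cycle e c].

Definition spanning_tree (V : finType) (e t : rel V) : Prop :=
  [/\ symmetric t, subrel t e, gconnected t & forall c, ~~ graph_cycle t c].

Definition same_edge (V : finType) (x y u v : V) : bool :=
  (x == u) && (y == v) || (x == v) && (y == u).

Definition add_edge (V : finType) (t : rel V) (x y : V) : rel V :=
  [rel u v | t u v || same_edge x y u v].

(* For a spanning tree [t] and an edge [xy] outside it, the cycle is unique
   up to the choice of a starting point and an orientation. *)
Definition fundamental_cycle (V : finType) (t : rel V) (x y : V) (c : seq V) :
  bool := graph_cycle (add_edge t x y) c.

Definition nonseparating (V : finType) (e : rel V) (c : seq V) : Prop :=
  (forall v, v \in c) \/ gconnected_on e [set v | v \notin c]%SET.

Definition fundamental_Tutte_tree (V : finType) (e t : rel V) : Prop :=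
  spanning_tree e t /\
  forall (x y : V) (c : seq V), e x y -> ~~ t x y ->
    fundamental_cycle t x y c -> nonseparating e c.

Definition leaf (V : finType) (t : rel V) (v : V) : bool :=
  #|[set w | t v w]%SET| == 1%N.

(** * Drawings in the plane [R * R] *)

Definition is_arc (R : realType) (p q : R * R) (A : set (R * R)) : Prop :=
  exists g : R -> R * R,
    [/\ {within `[0, 1], continuous g}, {in `[0, 1] &, injective g},
        g 0 = p, g 1 = q & A = g @` `[0, 1]].

(* [pt v] is the point representing [v], and [ed u v] the closed arc (with its
   endpoints) representing the edge [uv]; [ed u v] is irrelevant when [u] and
   [v] are not adjacent. *)
Record plane_drawing (R : realType) (V : finType) (e : rel V)
    (pt : V -> R * R) (ed : V -> V -> set (R * R)) : Prop := PlaneDrawing {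
  drawing_inj : injective pt;
  drawing_sym : forall u v, e u v -> ed u v = ed v u;
  drawing_arc : forall u v, e u v -> is_arc (pt u) (pt v) (ed u v);
  drawing_vertex : forall u v w, e u v -> ed u v (pt w) -> w = u \/ w = v;
  drawing_cross : forall u v u' v' z, e u v -> e u' v' ->
    ~~ same_edge u v u' v' -> ed u v z -> ed u' v' z -> exists w, z = pt w }.

Definition planar (R : realType) (V : finType) (e : rel V) : Prop :=
  exists (pt : V -> R * R) (ed : V -> V -> set (R * R)),
    plane_drawing e pt ed.

Definition drawing_support (R : realType) (V : finType) (e : rel V)
    (pt : V -> R * R) (ed : V -> V -> set (R * R)) : set (R * R) :=
  range pt `|` [set z | exists u v, e u v /\ ed u v z].

Definition is_face (R : realType) (V : finType) (e : rel V)
    (pt : V -> R * R) (ed : V -> V -> set (R * R)) (F : set (R * R)) : Prop :=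
  exists2 p, (~` drawing_support e pt ed) p &
    F = connected_component (~` drawing_support e pt ed) p.

Definition boundary (T : topologicalType) (A : set T) : set T :=
  closure A `\` A°.

(* Main.v *)
(* The complement of the drawn tree is connected and has every vertex in its
   closure. Add the other edges one at a time, keeping a face whose closure
   contains all leaves. When an edge xy splits this face, the leaves off its
   fundamental cycle C all lie on the same side of C, because G - C is
   connected, so exactly one piece can be, and is, adjacent to them; the only
   leaves that may lie on C are x and y, which are on the boundary of every
   piece.

   The separation properties of the plane come from Eilenberg's criterion: a
   compact set K does not separate p from q iff (z - p) / (z - q) has a
   continuous argument on K. Arguments can be glued along a connected
   intersection (Janiszewski's theorem), and they always exist on arcs. *)

(* The invariant is carried by linkedness classes instead of faces because Janiszewski's theorem is
   a statement about linkedness. Let [H] be the current drawing, [A] the arc of the new edge and [C]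
   the drawn fundamental cycle, made of [A] and the drawn tree path [P]. Then [H] and [C] meet
   exactly in [P], which is connected, and their union is the new drawing; so two points linked off
   [H] and linked off [C] are linked off the new drawing. Being in one old face and on one side of
   [C] thus suffices to remain together, and how many pieces the face falls into need not be
   counted. Actual components reappear only where a connected set has to be followed up to the new
   arc, and at the very end.

   The quotient is written as [z - p] times the conjugate of [z - q], a positive multiple of it:
   only directions count, and no division occurs. *)
Require Import Defs.
From HB Require Import structures.
From mathcomp Require Import all_boot all_order all_algebra.
From mathcomp Require Import all_classical all_reals all_analysis.
From mathcomp Require Import ring lra.
Import Order.TTheory GRing.Theory Num.Theory.
Import numFieldNormedType.Exports.

Set Implicit Arguments.
Unset Strict Implicit.
Unset Printing Implicit Defensive.

Local Open Scope classical_set_scope.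
Local Open Scope ring_scope.

(** * Continuous arguments *)

(** The points of [S] satisfying [P] form a relatively open and relatively closed part. This is the
    continuation principle behind homotopies, arcs and paths avoiding a compact set. *)
Lemma connected_locally_constant (T : topologicalType) (S : set T)
    (P : T -> Prop) :
  connected S ->
  (forall x, S x -> \forall y \near x, S y -> (P x <-> P y)) ->
  forall x y, S x -> S y -> P x -> P y.
Proof.
move=> cS loc x y Sx Sy Px.
suff SP : S `&` P = S by have [] : (S `&` P) y by rewrite SP.
apply: cS; first by exists x.
- exists (interior [set y | S y -> P y]); first exact: open_interior.
  apply/seteqP; split=> z [Sz Pz]; split=> //; last exact: interior_subset Pz _.
  by apply: filterS (loc _ Sz) => w Pzw Sw; apply/Pzw.
exists (closure (S `&` P)); first exact: closed_closure.
apply/seteqP; split=> z [Sz Pz]; split=> //; first exact: subset_closure.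
by have [w [[Sw Pw] /(_ Sw)]] := Pz _ (loc _ Sz); case=> _; exact.
Qed.

Lemma within_continuous_comp_subset (X Y Z : topologicalType)
    (A : set X) (B : set Y) (f : X -> Y) (g : Y -> Z) :
  {within A, continuous f} -> (forall x, A x -> B (f x)) ->
  {within B, continuous g} -> {within A, continuous (g \o f)}.
Proof.
move=> /subspace_continuousP cf AB /subspace_continuousP cg.
apply/subspace_continuousP => x Ax.
move=> W /(cg _ (AB _ Ax)) /(cf _ Ax); rewrite /nbhs/= /within/=.
by apply: filterS => y yW Ay; apply: yW => //; exact: AB.
Qed.

Section Angles.
Context {R : realType}.
Implicit Types (p q a b : R * R) (K A B : set (R * R)) (f g : R * R -> R * R).

Definition cmul a b : R * R := (a.1 * b.1 - a.2 * b.2, a.1 * b.2 + a.2 * b.1).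
Definition conjp a : R * R := (a.1, - a.2).
Lemma scalep (r : R) a : r *: a = (r * a.1, r * a.2).
Proof. by []. Qed.

(** This is the real part of [a] times the conjugate of [b]. Its positivity says that the two
    directions differ by less than a right angle, the notion of closeness used for angles
    throughout. *)
Definition dot a b : R := a.1 * b.1 + a.2 * b.2.
Definition polar (r t : R) : R * R := (r * cos t, r * sin t).

Lemma cvg_coord (T : Type) (F : set_system T) {FF : Filter F}
  (f : T -> R * R) a :
  f @ F --> a <->
  (fun x => (f x).1) @ F --> a.1 /\ (fun x => (f x).2) @ F --> a.2.
Proof.
split=> [fa|[fa1 fa2]]; last first.
  move=> W /= [[U1 U2] /= [aU1 aU2] UW]; rewrite /nbhs/=.
  have F1 : F [set x | U1 (f x).1] := fa1 _ aU1.
  have F2 : F [set x | U2 (f x).2] := fa2 _ aU2.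
  by apply: filterS (filterI F1 F2) => x [u1 u2]; apply: UW.
split=> W /= aW.
  have /fa : nbhs a (W `*` setT).
    by exists (W, setT) => //=; split=> //; exact: filterT.
  by rewrite /nbhs/=; apply: filterS => x [].
have /fa : nbhs a (setT `*` W).
  by exists (setT, W) => //=; split=> //; exact: filterT.
by rewrite /nbhs/=; apply: filterS => x [].
Qed.

Lemma cvg_conjp (T : Type) (F : set_system T) {FF : Filter F} (f : T -> R * R)
  a : f @ F --> a -> (fun x => conjp (f x)) @ F --> conjp a.
Proof.
by move=> /cvg_coord[fa1 fa2]; apply/cvg_coord; split=> //=; exact: cvgN.
Qed.

Lemma cvg_cmul (T : Type) (F : set_system T) {FF : Filter F}
  (f g : T -> R * R) a b : f @ F --> a -> g @ F --> b ->
  (fun x => cmul (f x) (g x)) @ F --> cmul a b.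
Proof.
move=> /cvg_coord[fa1 fa2] /cvg_coord[gb1 gb2]; apply/cvg_coord; split.
  exact: cvgB (cvgM fa1 gb1) (cvgM fa2 gb2).
exact: cvgD (cvgM fa1 gb2) (cvgM fa2 gb1).
Qed.

Lemma cvg_dot (T : Type) (F : set_system T) {FF : Filter F}
  (f g : T -> R * R) a b : f @ F --> a -> g @ F --> b ->
  (fun x => dot (f x) (g x)) @ F --> dot a b.
Proof.
move=> /cvg_coord[fa1 fa2] /cvg_coord[gb1 gb2].
exact: cvgD (cvgM fa1 gb1) (cvgM fa2 gb2).
Qed.

Lemma dotC a b : dot a b = dot b a.
Proof. by rewrite /dot mulrC [X in _ + X]mulrC. Qed.

Lemma dot_gt0 a : a != 0 -> 0 < dot a a.
Proof.
move=> a0; rewrite lt_neqAle eq_sym addr_ge0 -?expr2 ?sqr_ge0// andbT.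
apply: contra a0; rewrite /dot -!expr2 paddr_eq0 ?sqr_ge0// !sqrf_eq0.
by case: a => a1 a2 /= /andP[/eqP-> /eqP->].
Qed.

(** A continuous branch of the argument of [f] on [K]. The modulus is left free at each point, so
    positive rescaling is harmless; being positive, it forces [f] to have no zero on [K]. *)
Definition has_angle K f : Prop :=
  exists th : R * R -> R, {within K, continuous th} /\
    forall z, K z -> exists2 r, 0 < r & f z = polar r (th z).

Lemma has_angle_sub A B f : A `<=` B -> has_angle B f -> has_angle A f.
Proof.
move=> AB [th [cth thE]]; exists th; split; first exact: continuous_subspaceW cth.
by move=> z /AB /thE.
Qed.

Lemma has_angle_scale K f g :
  (forall z, K z -> exists2 r, 0 < r & g z = r *: f z) ->
  has_angle K f -> has_angle K g.
Proof.
move=> fg [th [cth thE]]; exists th; split=> // z Kz.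
have [r r0 ->] := fg _ Kz; have [s s0 ->] := thE _ Kz.
exists (r * s); first exact: mulr_gt0.
by rewrite /polar /= -!mulrA.
Qed.

Lemma has_angle_mul K f g : has_angle K f -> has_angle K g ->
  has_angle K (fun z => cmul (f z) (g z)).
Proof.
move=> [th [cth thE]] [ph [cph phE]]; exists (fun z => th z + ph z); split.
  by move=> z; apply: cvgD; [exact: cth|exact: cph].
move=> z Kz; have [r r0 ->] := thE _ Kz; have [s s0 ->] := phE _ Kz.
exists (r * s); first exact: mulr_gt0.
by rewrite /cmul /polar /= cosD sinD; congr pair; ring.
Qed.

Lemma has_angle_conj K f : has_angle K f -> has_angle K (fun z => conjp (f z)).
Proof.
move=> [th [cth thE]]; exists (fun z => - th z); split.
  by move=> z; apply: cvgN; exact: cth.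
move=> z Kz; have [r r0 ->] := thE _ Kz; exists r => //.
by rewrite /conjp /polar /= cosN sinN mulrN.
Qed.

Lemma within_continuous_pair K f :
  {within K, continuous f} ->
  {within K, continuous (fun z => (f z).1)} /\
  {within K, continuous (fun z => (f z).2)}.
Proof.
move=> cf; split=> z.
  by apply: (cvg_comp _ _ (cf z)); exact: cvg_fst.
by apply: (cvg_comp _ _ (cf z)); exact: cvg_snd.
Qed.

Lemma has_angle_right K f : {within K, continuous f} ->
  (forall z, K z -> 0 < (f z).1) -> has_angle K f.
Proof.
move=> cf f0; have [cf1 cf2] := within_continuous_pair cf.
exists (fun z => atan ((f z).2 / (f z).1)); split.
  apply/subspace_continuousP => z Kz.
  move/subspace_continuousP: cf1 => /(_ _ Kz) cf1.
  move/subspace_continuousP: cf2 => /(_ _ Kz) cf2.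
  have f10 : (f z).1 != 0 by rewrite gt_eqF// f0.
  exact: cvg_comp (cvgM cf2 (cvgV f10 cf1)) (@continuous_atan R _).
move=> z Kz; set t := _ / _.
have c0 : 0 < cos (atan t).
  by rewrite cos_atan invr_gt0 sqrtr_gt0 ltr_wpDr// sqr_ge0.
exists ((f z).1 / cos (atan t)); first by rewrite divr_gt0// f0.
have := atanK t; rewrite /tan => tE.
have := f0 _ Kz; rewrite /polar /t => fz0.
rewrite [LHS]surjective_pairing; congr pair; first by rewrite divfK// gt_eqF.
by rewrite -mulrA [_^-1 * _]mulrC tE /t mulrC divfK// gt_eqF.
Qed.

Lemma has_angle_cst K a : a != 0 -> has_angle K (fun=> a).
Proof.
move=> a0.
suff [t [r r0 aE]] : exists t, exists2 r, 0 < r & a = polar r t.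
  exists (fun=> t); split; last by move=> z _; exists r.
  by move=> z; exact: cvg_cst.
have right b : 0 < b.1 -> exists t, exists2 r, 0 < r & b = polar r t.
  move=> b0; have [|//|th [_ /(_ b I)[r r0 bE]]] := @has_angle_right setT (fun=> b).
    by move=> z; exact: cvg_cst.
  by exists (th b), r.
have [a1|a1|a1] := ltrgtP a.1 0.
- have [|t [r r0 E]] := right (- a.1, - a.2); first by rewrite oppr_gt0.
  exists (t + pi), r => //; rewrite /polar cosDpi sinDpi !mulrN.
  by case: E => <- <-; rewrite !opprK -surjective_pairing.
- exact: right.
have [a2|a2|a2] := ltrgtP a.2 0.
- exists (- (pi / 2)), (- a.2); first by rewrite oppr_gt0.
  rewrite /polar cosN sinN cos_pihalf sin_pihalf.
  by rewrite mulr0 mulrN mulr1 opprK -a1 -surjective_pairing.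
- exists (pi / 2), a.2 => //.
  by rewrite /polar cos_pihalf sin_pihalf mulr0 mulr1 -a1 -surjective_pairing.
by move: a0; rewrite [a]surjective_pairing a1 a2 eqxx.
Qed.

(** The product of [f] with the conjugate of [g] stays in the right half-plane, where arctangent
    provides an angle; multiplying back by [g] gives [f] up to the positive factor [dot g g]. *)
Lemma has_angle_close K f g : {within K, continuous f} ->
  {within K, continuous g} -> (forall z, K z -> 0 < dot (f z) (g z)) ->
  has_angle K g -> has_angle K f.
Proof.
move=> cf cg fg ag.
have afg : has_angle K (fun z => cmul (f z) (conjp (g z))).
  apply: has_angle_right => [z|z Kz /=].
    exact: (cvg_cmul (cf z) (cvg_conjp (cg z))).
  by have := fg _ Kz; rewrite /dot mulrN opprK.
apply: has_angle_scale (has_angle_mul afg ag) => z Kz.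
have n0 : 0 < dot (g z) (g z).
  apply: dot_gt0; apply/eqP => gz; have := fg _ Kz.
  by rewrite gz /dot !mulr0 addr0 ltxx.
exists (dot (g z) (g z))^-1; first by rewrite invr_gt0.
move: n0; rewrite /dot /cmul /conjp /= => n0.
rewrite [LHS]surjective_pairing; congr pair => /=.
  by rewrite /GRing.scale/=; field; rewrite gt_eqF.
by rewrite /GRing.scale/=; field; rewrite gt_eqF.
Qed.

Lemma cos_eq1_connected (T : topologicalType) (S : set T) (d : T -> R) :
  connected S -> {within S, continuous d} -> (forall z, S z -> cos (d z) = 1) ->
  forall z w, S z -> S w -> d z = d w.
Proof.
move=> cS cd d1.
have /connected_intervalP iS : connected (d @` S).
  exact: connected_continuous_connected.
suff le z w : S z -> S w -> d z <= d w.
  by move=> z w Sz Sw; apply/eqP; rewrite eq_le !le.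
move=> Sz Sw; rewrite leNgt; apply/negP => wz.
(* Being at most the gap, [s] keeps [d w + s] in the interval of values of [d]; being in []0, pi]],
   it has cosine below 1. *)
pose s := Num.min pi (d z - d w).
have s0 : 0 < s by rewrite lt_min pi_gt0 subr_gt0.
have spi : s <= pi by rewrite ge_min lexx.
have [v Sv dv] : (d @` S) (d w + s).
  apply: (iS (d w) (d z)); [by exists w|by exists z|].
  by rewrite lerDl ltW//= -lerBrDl ge_min lexx orbT.
have : cos s = 1.
  have := d1 _ Sv; rewrite dv cosD (d1 _ Sw) mul1r.
  have -> : sin (d w) = 0.
    by apply/eqP; rewrite -sqrf_eq0 sin2cos2 d1// expr1n subrr.
  by rewrite mul0r subr0.
have : cos s < cos 0 by rewrite ltr_cos ?in_itv/= ?lexx ?pi_ge0// ltW.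
by rewrite cos0 => /lt_eqF /eqP.
Qed.


(** Equality of angles modulo [2 * pi] is expressed by a cosine equal to 1, the form that
    [cos_eq1_connected] takes as input. *)
Lemma polar_inj_angle (r s t u : R) :
  0 < r -> 0 < s -> polar r t = polar s u -> cos (t - u) = 1.
Proof.
move=> r0 s0 [E1 E2].
have rs : r = s.
  apply/eqP; rewrite -(@eqrXn2 _ 2)// ?ltW//; apply/eqP.
  have /(congr1 (fun x => x * r ^+ 2)) := cos2Dsin2 t.
  have /(congr1 (fun x => x * s ^+ 2)) := cos2Dsin2 u.
  rewrite !mul1r => <- <-.
  transitivity ((r * cos t) ^+ 2 + (r * sin t) ^+ 2); first by ring.
  by rewrite E1 E2; ring.
move: E1 E2; rewrite rs => /(mulfI (lt0r_neq0 s0)) E1 /(mulfI (lt0r_neq0 s0)) E2.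
by rewrite cosB E1 E2 -!expr2 cos2Dsin2.
Qed.

(* On a connected set two angles differ by a constant multiple of [2 pi], so
   one of them can be shifted to match the other. *)
Lemma has_angle_glue A B f : closed A -> closed B -> connected (A `&` B) ->
  has_angle A f -> has_angle B f -> has_angle (A `|` B) f.
Proof.
move=> clA clB cAB [th [cth thE]] [ph [cph phE]].
have [c c1 cE] : exists2 c, cos c = 1 &
    forall z, (A `&` B) z -> th z = ph z + c.
  (* The empty set counts as connected; for disjoint pieces any admissible shift will do, here 0. *)
  have [[x ABx]|AB0] := pselect ((A `&` B) !=set0); last first.
    by exists 0; [rewrite cos0|move=> z ABz; case: AB0; exists z].
  have d1 z : (A `&` B) z -> cos (th z - ph z) = 1.
    move=> [/thE[r r0 rE] /phE[s s0 sE]].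
    by apply: (polar_inj_angle r0 s0); rewrite -rE -sE.
  exists (th x - ph x); first exact: d1.
  move=> z ABz; rewrite (@cos_eq1_connected _ _ (fun z => th z - ph z) cAB _ d1 x z)//.
    by rewrite addrC subrK.
  by move=> w; apply: cvgB; [apply: (continuous_subspaceW (@subIsetl _ _ _) cth)
                           |apply: (continuous_subspaceW (@subIsetr _ _ _) cph)].
have s0 : sin c = 0.
  by apply/eqP; rewrite -sqrf_eq0 sin2cos2 c1 expr1n subrr.
pose ch z := if z \in A then th z else ph z + c.
have chA z : A z -> ch z = th z by move=> Az; rewrite /ch mem_set.
have chB z : B z -> ch z = ph z + c.
  move=> Bz; rewrite /ch; case: ifPn => // /set_mem Az; exact: cE.
exists ch; split.
  apply: withinU_continuous => //.
    apply: (@subspace_eq_continuous _ _ _ th) => //.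
    by move=> z /set_mem /chA.
  apply: (@subspace_eq_continuous _ _ _ (fun z => ph z + c)).
    by move=> z /set_mem /chB.
  by move=> z; apply: cvgD; [exact: cph|exact: cvg_cst].
move=> z [Az|Bz]; first by rewrite chA//; exact: thE.
have [r r0 rE] := phE _ Bz; exists r => //.
by rewrite chB// rE /polar cosD sinD c1 s0 !mulr0 !mulr1 subr0 addr0.
Qed.


Definition circle p (r : R) : set (R * R) :=
  [set p + polar r t | t in `[0, 2 * pi]].

Lemma continuous_polar r : continuous (polar r).
Proof.
move=> t; apply/cvg_coord.
by split; apply: cvgMr; [exact: continuous_cos|exact: continuous_sin].
Qed.

Lemma within_continuous_circle p r (A : set R) :
  {within A, continuous (fun t => p + polar r t)}.
Proof.
apply: continuous_subspaceT => t.
by apply: cvgD; [exact: cvg_cst|exact: continuous_polar].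
Qed.

Lemma compact_circle p r : compact (circle p r).
Proof.
apply: continuous_compact; first exact: within_continuous_circle.
exact: segment_compact.
Qed.

Lemma connected_circle p r : connected (circle p r).
Proof.
apply: connected_continuous_connected; last exact: within_continuous_circle.
exact: segment_connected.
Qed.

(** Along the parametrization an angle would differ from the parameter by a constant, yet it takes
    the same value at both ends while the parameter grows by [2 * pi]. *)
Lemma circle_no_angle p r : 0 < r -> ~ has_angle (circle p r) (fun z => z - p).
Proof.
move=> r0 [th [cth thE]].
pose g t := p + polar r t.
have gC t : `[0, 2 * pi]%classic t -> circle p r (g t) by move=> It; exists t.
have cd : {within `[0, 2 * pi], continuous (fun t => th (g t) - t)}.
  move=> t; apply: cvgB; last first.
    by apply: (@continuous_subspaceT _ _ _ (fun x : R => x)) => x; exact: cvg_id.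
  have cgt : {within `[0, 2 * pi], continuous g} by exact: within_continuous_circle.
  exact: (within_continuous_comp_subset cgt gC cth).
have d1 t : `[0, 2 * pi]%classic t -> cos (th (g t) - t) = 1.
  move=> It; have [s s0 sE] := thE _ (gC _ It).
  rewrite -cosN opprB; apply: (polar_inj_angle r0 s0); rewrite -sE /g.
  by rewrite addrC addKr.
have pi2 : 0 <= 2 * pi :> R by rewrite mulr_ge0// pi_ge0.
have := cos_eq1_connected (@segment_connected _ 0 (2 * pi)) cd d1
  (_ : `[0, 2 * pi]%classic 0) (_ : `[0, 2 * pi]%classic (2 * pi)).
rewrite /= !in_itv/= !lexx pi2 => /(_ isT isT).
have -> : g (2 * pi) = g 0.
  by rewrite /g /polar cos0 sin0 mulr_natl cos2pi sin2pi.
move=> /addrI /oppr_inj /esym /eqP; rewrite mulf_eq0 pnatr_eq0/=.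
by rewrite gt_eqF// pi_gt0.
Qed.

(** By compactness of [K], for [s] near [t] the directions of [H s] and [H t] are close on all of
    [K] at once, so having an angle is locally constant in the time parameter. *)
Lemma has_angle_homotopy K (H : R -> R * R -> R * R) : compact K ->
  continuous (fun x : R * (R * R) => H x.1 x.2) ->
  (forall t z, `[0, 1]%classic t -> K z -> H t z != 0) ->
  has_angle K (H 0) -> has_angle K (H 1).
Proof.
move=> /compact_near_coveringP cK cH H0.
have cHt t : continuous (H t).
  move=> z.
  exact: (cvg_comp _ _ (cvg_pair (@cvg_cst _ t _ _ _) cvg_id) (cH (t, z))).
apply: (connected_locally_constant (P := fun t => has_angle K (H t))
  (@segment_connected _ 0 1)); last 2 first.
- by rewrite /= in_itv/= lexx ler01.
- by rewrite /= in_itv/= lexx ler01.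
move=> t It.
have pos : \forall s \near t, K `<=` [set z | 0 < dot (H t z) (H s z)].
  apply: (cK R (nbhs t) (fun s z => 0 < dot (H t z) (H s z))) => z Kz.
  have : (fun w => dot (H t w.1) (H w.2 w.1)) @ (nbhs z, nbhs t) -->
      dot (H t z) (H t z).
    apply: cvg_dot.
      exact: (cvg_comp _ _ (@cvg_fst _ _ (nbhs z) (nbhs t) _) (cHt t z)).
    exact: (cvg_comp _ _ (cvg_pair cvg_snd cvg_fst) (cH (t, z))).
  move=> /cvgr_gt /(_ _ (dot_gt0 (H0 _ _ It Kz))).
  by [].
apply: filterS pos => s pos Is.
have cW u : {within K, continuous (H u)} by exact: continuous_subspaceT.
split=> [/(has_angle_close (cW s) (cW t))|/(has_angle_close (cW t) (cW s))].
  by apply=> z Kz; rewrite dotC; exact: (pos z).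
by apply=> z Kz; exact: (pos z).
Qed.

Lemma closed_image_segment (g : R -> R * R) (a b : R) :
  {within `[a, b], continuous g} -> closed (g @` `[a, b]).
Proof.
move=> cg; apply: compact_closed; first exact: norm_hausdorff.
by apply: continuous_compact => //; exact: segment_compact.
Qed.

(** Having an angle on the image of [[a, s]] is locally constant in [s]: on a short further piece
    [f] is close to the constant [f (g s)], and by injectivity of [g] this piece meets the earlier
    one in a single point, so the angles glue. *)
Lemma has_angle_arc (g : R -> R * R) f (a b : R) :
  {within `[a, b], continuous g} -> {in `[a, b] &, injective g} ->
  continuous f -> (forall t, `[a, b]%classic t -> f (g t) != 0) ->
  has_angle (g @` `[a, b]) f.
Proof.
move=> cg ig cf f0; have [ab|ba] := leP a b; last first.
  rewrite set_itv_ge ?bnd_simp -?ltNge// image_set0.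
  by exists (fun=> 0); split=> // z; exact: cvg_cst.
have Ia : `[a, b]%classic a by rewrite /= in_itv/= lexx.
have Ib : `[a, b]%classic b by rewrite /= in_itv/= lexx ab.
apply: (connected_locally_constant (P := fun s => has_angle (g @` `[a, s]) f)
  (@segment_connected _ a b) _ Ia Ib); last first.
  rewrite set_itv1 image_set1; have := has_angle_cst [set g a] (f0 _ Ia).
  apply: has_angle_scale => z ->; exists 1 => //; by rewrite scale1r.
move=> s Is.
have step (m M : R) : a <= m -> m <= M -> M <= b ->
    (forall u, `[m, M]%classic u -> 0 < dot (f (g u)) (f (g s))) ->
    has_angle (g @` `[a, m]) f <-> has_angle (g @` `[a, M]) f.
  move=> am mM Mb pos; split; last first.
    apply: has_angle_sub; apply: image_subset => u /=.
    by rewrite !in_itv/= => /andP[-> /le_trans->].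
  have sub1 : `[a, m] `<=` `[a, b].
    by move=> u /=; rewrite !in_itv/= => /andP[-> /le_trans->//]; exact: le_trans Mb.
  have sub2 : `[m, M] `<=` `[a, b].
    by move=> u /=; rewrite !in_itv/= => /andP[/(le_trans am)-> /le_trans->//].
  have UE : g @` `[a, M] = g @` `[a, m] `|` g @` `[m, M].
    rewrite -image_setU; congr (g @` _); apply/seteqP; split=> u /=.
      rewrite !in_itv/= => /andP[-> ->]; rewrite andbT.
      by case: (leP u m) => [|/ltW]; [left|right].
    by rewrite !in_itv/= => -[/andP[-> /le_trans->]//|/andP[/(le_trans am)-> ->]].
  move=> am_angle; rewrite UE; apply: has_angle_glue => //.
  - by apply: closed_image_segment; exact: continuous_subspaceW cg.
  - by apply: closed_image_segment; exact: continuous_subspaceW cg.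
  - have -> : g @` `[a, m] `&` g @` `[m, M] = [set g m].
      apply/seteqP; split=> [z [[u Iu <-] [v Iv]]|z ->]; last first.
        by split; exists m => //=; rewrite in_itv/= lexx ?am ?mM.
      move=> /(ig _ _ (sub2 _ Iv) (sub1 _ Iu)) vu; move: Iu Iv.
      rewrite vu /= !in_itv/= => /andP[_ um] /andP[mu _].
      by congr g; apply/eqP; rewrite eq_le um mu.
    exact: connected1.
  apply: (has_angle_close (g := fun=> f (g s))).
  - exact: continuous_subspaceT.
  - by apply: continuous_subspaceT => z; exact: cvg_cst.
  - by move=> z [u Iu <-]; exact: pos.
  - exact: has_angle_cst (f0 _ Is).
have : \forall u \near s, `[a, b]%classic u -> 0 < dot (f (g u)) (f (g s)).
  have cfg : {within `[a, b], continuous (f \o g)}.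
    apply: within_continuous_comp_subset cg (fun x _ => I) _.
    exact: (@continuous_subspaceT _ _ setT).
  move/subspace_continuousP : cfg => /(_ _ Is) cfg.
  have /cvgr_gt/(_ _ (dot_gt0 (f0 _ Is))) :
      (fun u => dot (f (g u)) (f (g s))) @ within `[a, b] (nbhs s) -->
      dot (f (g s)) (f (g s)).
    by apply: cvg_dot; [exact: cfg|exact: cvg_cst].
  by [].
move=> /nbhs_ballP[e /= e0 pos].
exists e => //= s' es' Is'.
have pos' u : Num.min s s' <= u <= Num.max s s' -> `[a, b]%classic u ->
    0 < dot (f (g u)) (f (g s)).
  move=> mu; apply: pos; move: es' mu; rewrite /ball/=.
  rewrite ge_min le_max => es' /andP[+ +].
  have [ss'|ss'] := leP s s'; rewrite !ltr_norml in es' *; lra.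
move: Is Is' pos'; rewrite /= !in_itv/= => /andP[sa sb] /andP[sa' sb'].
have [ss'|/ltW ss'] := leP s s' => pos'.
  apply: step => // u /=; rewrite in_itv/= => /andP[? ?]; apply: pos'.
    by apply/andP.
  by rewrite in_itv/= (le_trans sa)// (le_trans _ sb').
apply: iff_sym; apply: (step s' s) => // u /=.
rewrite in_itv/= => /andP[? ?]; apply: pos'.
  by apply/andP.
by rewrite in_itv/= (le_trans sa')// (le_trans _ sb).
Qed.

End Angles.

(** * Separation of the plane by compact sets *)

Section Linked.
Context {R : realType}.
Implicit Types (p q a b : R * R) (K A B S : set (R * R)).

Lemma cmul_eq0 a b : (cmul a b == 0) = (a == 0) || (b == 0).
Proof.
apply/eqP/orP => [ab0|[/eqP->|/eqP->]]; last 2 first.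
- by rewrite /cmul /= !mul0r subrr addr0.
- by rewrite /cmul /= !mulr0 subrr addr0.
have [|a0] := eqVneq a 0; [by left|right].
apply/contraT => b0; move: ab0 => [E1 E2].
have : dot a a * dot b b = 0.
  transitivity ((a.1 * b.1 - a.2 * b.2) ^+ 2 + (a.1 * b.2 + a.2 * b.1) ^+ 2).
    by rewrite /dot; ring.
  by rewrite E1 E2; ring.
by move=> /eqP; rewrite mulf_eq0 !gt_eqF// dot_gt0.
Qed.

Lemma conjp_eq0 a : (conjp a == 0) = (a == 0).
Proof. by case: a => a1 a2; rewrite /conjp -!pair_eqE /pair_eq/= oppr_eq0. Qed.

(* Eilenberg's criterion: for compact [K] and [p, q] outside [K], this holds
   exactly when [p] and [q] lie in the same component of the complement. *)
Definition linked K p q : Prop :=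
  has_angle K (fun z => cmul (z - p) (conjp (z - q))).

Lemma cvg_subr (T : Type) (F : set_system T) {FF : Filter F} (f : T -> R * R)
  a p : f @ F --> a -> (fun z => f z - p) @ F --> a - p.
Proof. by move=> fa; apply: cvgB => //; exact: cvg_cst. Qed.

Lemma continuous_quotient p q :
  continuous (fun z : R * R => cmul (z - p) (conjp (z - q))).
Proof.
move=> z; apply: cvg_cmul; last apply: cvg_conjp; apply: cvg_subr; exact: cvg_id.
Qed.

Lemma linked_sub A B p q : A `<=` B -> linked B p q -> linked A p q.
Proof. exact: has_angle_sub. Qed.

Lemma linked_dot K p q :
  (forall z, K z -> 0 < dot (z - p) (z - q)) -> linked K p q.
Proof.
move=> pos; apply: has_angle_right => [|z /pos].
  by apply: continuous_subspaceT; exact: continuous_quotient.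
by rewrite /dot /cmul /= mulrN opprK.
Qed.

Lemma linked_refl K p : ~ K p -> linked K p p.
Proof.
move=> Kp; apply: linked_dot => z Kz; apply: dot_gt0.
by rewrite subr_eq0; apply/eqP => zp; apply: Kp; rewrite -zp.
Qed.

Lemma linked_sym K p q : linked K p q -> linked K q p.
Proof.
move=> /has_angle_conj; apply: has_angle_scale => z Kz; exists 1 => //.
by rewrite scale1r /cmul /conjp /=; congr pair; ring.
Qed.

(** Multiplying the two quotients leaves the one for [p] and [s] times [dot (z - q) (z - q)], which
    is positive because [q] is off [K]. *)
Lemma linked_trans K p q s : ~ K q ->
  linked K p q -> linked K q s -> linked K p s.
Proof.
move=> Kq pq /(has_angle_mul pq); apply: has_angle_scale => z Kz.
have zq : 0 < dot (z - q) (z - q).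
  by apply: dot_gt0; rewrite subr_eq0; apply/eqP => zq; apply: Kq; rewrite -zq.
exists (dot (z - q) (z - q))^-1; first by rewrite invr_gt0.
move: zq; rewrite /dot /cmul /conjp /= => zq.
by rewrite scalep /=; congr pair; field; rewrite gt_eqF.
Qed.

Lemma linked_near K p : compact K -> ~ K p -> \forall q \near p, linked K p q.
Proof.
move=> /compact_near_coveringP cK Kp.
have pos : \forall q \near p, K `<=` [set z | 0 < dot (z - p) (z - q)].
  apply: (cK _ (nbhs p) (fun q z => 0 < dot (z - p) (z - q))) => z Kz.
  have zp : z - p != 0.
    by rewrite subr_eq0; apply/eqP => zp; apply: Kp; rewrite -zp.
  have /cvgr_gt/(_ _ (dot_gt0 zp)) :
      (fun w => dot (w.1 - p) (w.1 - w.2)) @ (nbhs z, nbhs p) -->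
      dot (z - p) (z - p).
    apply: cvg_dot; first by apply: cvg_subr; exact: cvg_fst.
    by apply: cvgB; [exact: cvg_fst|exact: cvg_snd].
  by [].
by apply: filterS pos => q /linked_dot.
Qed.

(** The easy half of Eilenberg's criterion: off [K], nearby points are linked, so linkedness to [p]
    is locally constant. *)
Lemma linked_connected K S p q : compact K -> connected S -> S `<=` ~` K ->
  S p -> S q -> linked K p q.
Proof.
move=> cK cS SK Sp Sq.
apply: (connected_locally_constant (P := linked K p) cS _ Sp Sq); last first.
  exact/linked_refl/SK.
move=> x Sx; apply: filterS (linked_near cK (SK _ Sx)) => y xy Sy.
split=> [px|py]; first by apply: linked_trans px xy; exact: SK.
by apply: linked_trans py (linked_sym xy); exact: SK.
Qed.

(* Janiszewski's theorem. *)
Lemma linked_setU A B p q : closed A -> closed B -> connected (A `&` B) ->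
  linked A p q -> linked B p q -> linked (A `|` B) p q.
Proof. exact: has_angle_glue. Qed.

(** An arc does not separate the plane: the quotient vanishes only at [p] and [q], hence has an
    angle along the arc. *)
Lemma linked_arc (g : R -> R * R) (a b : R) p q :
  {within `[a, b], continuous g} -> {in `[a, b] &, injective g} ->
  ~ (g @` `[a, b]) p -> ~ (g @` `[a, b]) q -> linked (g @` `[a, b]) p q.
Proof.
move=> cg ig gp gq; apply: has_angle_arc => //.
  exact: (@continuous_quotient p q).
move=> t It; rewrite cmul_eq0 conjp_eq0 !subr_eq0 negb_or.
by apply/andP; split; apply/eqP => E; [apply: gp|apply: gq]; rewrite -E; exists t.
Qed.

Lemma nbhs_connected_join p (W : set (R * R)) : nbhs p W ->
  \forall q \near p, exists S, [/\ connected S, S p, S q & S `<=` W].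
Proof.
move=> /nbhs_ballP[e /= e0 eW].
apply/nbhs_ballP; exists e => //= q pq.
exists ((fun t : R => p + t *: (q - p)) @` `[0, 1]); split.
- apply: connected_continuous_connected; first exact: segment_connected.
  apply: continuous_subspaceT => t; apply: cvgD; first exact: cvg_cst.
  by apply: cvgZr_tmp; exact: cvg_id.
- by exists 0; rewrite ?scale0r ?addr0//= in_itv/= lexx ler01.
- by exists 1; rewrite ?scale1r ?subrKC//= in_itv/= lexx ler01.
move=> _ [t It <-]; apply: eW; move: pq; rewrite -ball_normE /=.
rewrite opprD addNKr normrN normrZ distrC => pq.
apply: le_lt_trans pq; rewrite ler_piMl//.
by move: It; rewrite /= in_itv/= => /andP[t0 t1]; rewrite ger0_norm.
Qed.

Lemma open_component K p : closed K -> open (connected_component (~` K) p).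
Proof.
move=> cK; rewrite openE => z Uz.
have Kz : nbhs z (~` K).
  apply: open_nbhs_nbhs; split; first exact: closed_openC.
  exact: connected_component_sub Uz.
apply: filterS (nbhs_connected_join Kz) => w [S [cS Sz Sw SK]].
apply: (connected_component_trans Uz); exists S => //.
Qed.

(** What remains is the union of the other components of the complement of [K], an open set.
    Together with the complement of the component this gives two closed sets covering the plane, as
    gluing requires. *)
Lemma closed_componentU K p :
  closed K -> closed (connected_component (~` K) p `|` K).
Proof.
move=> cK; rewrite -[X in closed X]setCK; apply: open_closedC.
rewrite setCU openE => z [Uz Kz].
have Kz' : nbhs z (~` K) by apply: open_nbhs_nbhs; split => //; exact: closed_openC.
apply: filterS (nbhs_connected_join Kz') => w [S [cS Sz Sw SK]].
split; last exact: SK.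
move=> Uw; apply: Uz; apply: (connected_component_trans Uw).
by exists S.
Qed.

Definition unitv a : R * R := (Num.sqrt (dot a a))^-1 *: a.

Lemma unitv_eq0 a : (unitv a == 0) = (a == 0).
Proof.
rewrite /unitv scaler_eq0 invr_eq0 sqrtr_eq0.
have [->|a0] := eqVneq a 0; first by rewrite orbT.
by rewrite leNgt dot_gt0.
Qed.

Lemma cvg_unitv (T : Type) (F : set_system T) {FF : Filter F}
  (f : T -> R * R) a : a != 0 ->
  f @ F --> a -> (fun x => unitv (f x)) @ F --> unitv a.
Proof.
move=> a0 fa; apply: cvgZ => //; apply: cvgV.
  by rewrite sqrtr_eq0 -ltNge dot_gt0.
exact: (cvg_comp _ _ (cvg_dot fa fa) (@sqrt_continuous _ _)).
Qed.

Lemma circle_dot p (r : R) z : circle p r z -> dot (z - p) (z - p) = r ^+ 2.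
Proof.
move=> [t _ <-]; rewrite addrC addKr /dot /polar /=.
by rewrite -!expr2 !exprMn -mulrDr cos2Dsin2 mulr1.
Qed.

(** An argument of the quotient is the rotation that carries the direction of [b] to that of [a].
    This makes the two halves of the glued map in [linked_component] agree on [K]. *)
Lemma polar_unitv a b (r t : R) : a != 0 -> b != 0 -> 0 < r ->
  cmul a (conjp b) = polar r t -> unitv a = cmul (polar 1 t) (unitv b).
Proof.
move=> a0 b0 r0 abE; have da := dot_gt0 a0; have db := dot_gt0 b0.
have rE : r = Num.sqrt (dot a a) * Num.sqrt (dot b b).
  rewrite -sqrtrM ?ltW// -[LHS]gtr0_norm// -sqrtr_sqr; congr Num.sqrt.
  move: abE => [E1 E2].
  transitivity ((r * cos t) ^+ 2 + (r * sin t) ^+ 2).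
    by rewrite !exprMn -mulrDr cos2Dsin2 mulr1.
  by rewrite -E1 -E2 /dot /=; ring.
have sa : 0 < Num.sqrt (dot a a) by rewrite sqrtr_gt0.
have sb : 0 < Num.sqrt (dot b b) by rewrite sqrtr_gt0.
move: sa sb rE; rewrite /unitv.
set x := Num.sqrt (dot a a); set y := Num.sqrt (dot b b) => x0 y0 rE.
have yE : y ^+ 2 = b.1 ^+ 2 + b.2 ^+ 2 by rewrite sqr_sqrtr ?ltW// /dot !expr2.
have : cmul (polar r t) b = y ^+ 2 *: a.
  by rewrite -abE yE /cmul /conjp scalep /=;
     congr pair; ring.
move=> /(congr1 (fun v => (x^-1 * (y ^+ 2)^-1) *: v)).
rewrite scalerA -mulrA mulVf ?expf_neq0 ?gt_eqF// mulr1 => <-.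
rewrite rE /polar /cmul !scalep /=.
by congr pair; field; rewrite !gt_eqF.
Qed.

Lemma cvg_polar (T : Type) (F : set_system T) {FF : Filter F} (th : T -> R)
  (r t : R) : th @ F --> t -> (fun x => polar r (th x)) @ F --> polar r t.
Proof. by move=> /(cvg_comp _ _) /(_ (@continuous_polar R r t)). Qed.


Lemma compact_disc_bound K p q : compact K ->
  exists r : R, [/\ 0 < r, dot (q - p) (q - p) < r ^+ 2 &
    forall z, K z -> dot (z - p) (z - p) < r ^+ 2].
Proof.
move=> cK; have : compact ((fun z => dot (z - p) (z - p) : R^o) @` K).
  apply: continuous_compact => //; apply: continuous_subspaceT => z.
  by apply: cvg_dot; apply: cvg_subr; exact: cvg_id.
move=> /compact_bounded[M [Mr MK]].
(* The summand 1 ensures [r <= r ^+ 2], so it is enough to bound the squared distances by [r]. *)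
pose m := `|M| + 1; pose r := 1 + m + dot (q - p) (q - p).
have m0 : 0 < m by rewrite ltr_wpDl.
have d0 : 0 <= dot (q - p) (q - p) by rewrite /dot -!expr2 addr_ge0// sqr_ge0.
have r1 : 1 <= r by rewrite /r; lra.
have rr : r <= r ^+ 2 by rewrite expr2 ler_peMl//; lra.
exists r; split; [lra|by apply: lt_le_trans rr; rewrite /r; lra|].
move=> z Kz; apply: lt_le_trans rr; apply: (@le_lt_trans _ _ m); last first.
  by rewrite /r; lra.
apply: le_trans (ler_norm _) _; apply: MK; last by exists z.
by rewrite /m; apply: le_lt_trans (ler_norm _) _; rewrite ltrDl.
Qed.

(* Otherwise the angle of the quotient, extended by Tietze's theorem, glues
   the direction of [z - p] outside the component of [p] to a rotation of the
   direction of [z - q] inside it: this is a nonvanishing map on the plane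
   whose restriction to a large circle has winding number one. *)
Lemma linked_component K p q : compact K -> ~ K p -> ~ K q -> linked K p q ->
  connected_component (~` K) p q.
Proof.
move=> cK Kp Kq pq; apply: contrapT; set U := connected_component _ _ => Uq.
have clK : closed K by apply: compact_closed => //; exact: norm_hausdorff.
have Up : U p by apply: connected_component_refl.
have [r [r0 qr Kr]] := compact_disc_bound p q cK.
move: (pq) => [th [cth thE]].
have [M M0 thM] : exists2 M : R, 0 < M & forall z, K z -> `|th z| <= M.
  have : compact ((th : _ -> R^o) @` K) by exact: continuous_compact.
  move=> /compact_bounded[M [Mr MK]].
  exists (`|M| + 1); first by rewrite ltr_wpDl.
  move=> z Kz; apply: MK; last by exists z.
  by apply: le_lt_trans (ler_norm _) _; rewrite ltrDl.
have [Th [ThE cTh _]] := continuous_bounded_extension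
  (@pseudometric_normal R _) clK M0 cth thM.
pose hp z := unitv (z - p).
pose hq z := cmul (polar 1 (Th z)) (unitv (z - q)).
pose h z := if z \in U then hq z else hp z.
have hU z : U z -> h z = hq z by move=> Uz; rewrite /h mem_set.
have hNU z : ~ U z -> h z = hp z by move=> Uz; rewrite /h memNset.
have KU z : K z -> ~ U z by move=> Kz /connected_component_sub.
have subr_neq0 (z w : R * R) : z <> w -> z - w != 0.
  by move=> zw; rewrite subr_eq0; exact/eqP.
have hK z : K z -> hp z = hq z.
  move=> Kz; have [s s0 sE] := thE _ Kz.
  rewrite /hp /hq -ThE ?inE//; apply: (polar_unitv _ _ s0 sE).
    by apply: subr_neq0 => zp; apply: Kp; rewrite -zp.
  by apply: subr_neq0 => zq; apply: Kq; rewrite -zq.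
have cp z : z <> p -> {for z, continuous hp}.
  by move=> zp; apply: cvg_unitv; [exact: subr_neq0|apply: cvg_subr; exact: cvg_id].
have cq z : z <> q -> {for z, continuous hq}.
  move=> zq; apply: cvg_cmul; first by apply: cvg_polar; exact: cTh.
  by apply: cvg_unitv; [exact: subr_neq0|apply: cvg_subr; exact: cvg_id].
have ch : continuous h.
  apply/continuous_subspace_setT.
  have -> : [set: R * R] = ~` U `|` (U `|` K).
    by rewrite setUA setUC [~` U `|` _]setUC setUv setUT.
  apply: withinU_continuous.
  - by apply: open_closedC; exact: open_component.
  - exact: closed_componentU.
  - apply: (@subspace_eq_continuous _ _ _ hp).
      by move=> z /set_mem Uz; exact: esym (hNU _ Uz).
    apply: continuous_in_subspaceT => z /set_mem Uz.
    by apply: cp => zp; apply: Uz; rewrite zp.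
  apply: (@subspace_eq_continuous _ _ _ hq).
    move=> z /set_mem [Uz|Kz]; first exact: esym (hU _ Uz).
    by rewrite -hK//; exact: esym (hNU _ (KU _ Kz)).
  apply: continuous_in_subspaceT => z /set_mem UKz.
  by apply: cq => zq; case: UKz; rewrite zq.
have h0 z : h z != 0.
  have [Uz|Uz] := pselect (U z).
    rewrite hU// cmul_eq0 unitv_eq0 negb_or subr_neq0 ?andbT; last first.
      by move=> zq; apply: Uq; rewrite -zq.
    apply/eqP => -[/eqP + /eqP]; rewrite !mul1r => /eqP c0 /eqP s0.
    have := cos2Dsin2 (Th z); rewrite c0 s0 !expr0n/= addr0 => /eqP.
    by rewrite eq_sym oner_eq0.
  by rewrite hNU// unitv_eq0 subr_neq0// => zp; apply: Uz; rewrite zp.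
have hC : has_angle (circle p r) h.
  (* Shrinking the circle to its centre deforms [h] to the constant [h p]; since [h] vanishes
     nowhere, the angle of that constant is carried back to [h]. *)
  pose H (t : R) z := h (p + t *: (z - p)).
  have H1 : has_angle (circle p r) (H 1).
    apply: (has_angle_homotopy (@compact_circle _ p r)) => //.
    - move=> -[t z]; apply: (cvg_comp (fun x : R * (R * R) => p + x.1 *: (x.2 - p))
        h _
        (ch (p + t *: (z - p)))).
      apply: cvgD; first exact: cvg_cst.
      apply: cvgZ; first exact: cvg_fst.
      by apply: cvg_subr; exact: cvg_snd.
    - by move=> t z _ _; exact: h0.
    apply: has_angle_scale (has_angle_cst _ (h0 p)) => z _; exists 1 => //.
    by rewrite /H scale0r addr0 scale1r.
  apply: has_angle_scale H1 => z _; exists 1 => //.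
  by rewrite /H !scale1r subrKC.
have CK z : circle p r z -> ~ K z.
  by move=> /circle_dot zr /Kr; rewrite zr ltxx.
have unit_scale A (c : R * R) : (forall z, A z -> z <> c) ->
    has_angle A (fun z => unitv (z - c)) -> has_angle A (fun z => z - c).
  move=> Ac; apply: has_angle_scale => z /Ac /subr_neq0 zc.
  have s0 : 0 < Num.sqrt (dot (z - c) (z - c)) by rewrite sqrtr_gt0 dot_gt0.
  exists (Num.sqrt (dot (z - c) (z - c))) => //.
  by rewrite /unitv scalerA divff ?scale1r// gt_eqF.
apply: (@circle_no_angle _ p r r0).
(* The circle is connected and misses [K], so it lies entirely outside [U] or entirely inside.
   Outside, [h] is the direction of [z - p]. Inside, undoing the rotation gives an angle for
   [z - q], which is then compared with [z - p]. *)
have [[w [Cw Uw]]|CU] := pselect (circle p r `&` U !=set0); last first.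
  apply: unit_scale => [z /circle_dot + zp|].
    rewrite zp subrr /dot mul0r addr0 => /esym/eqP.
    by rewrite sqrf_eq0 gt_eqF.
  apply: has_angle_scale hC => z Cz; exists 1 => //.
  by rewrite scale1r hNU// => Uz; apply: CU; exists z.
have CU z : circle p r z -> U z.
  move=> Cz; apply: (connected_component_trans Uw); exists (circle p r) => //.
  by split=> //; exact: connected_circle.
have aq : has_angle (circle p r) (fun z => z - q).
  apply: unit_scale => [z /CU Uz zq|]; first by apply: Uq; rewrite -zq.
  have aT : has_angle (circle p r) (fun z => polar 1 (Th z)).
    exists Th; split; first exact: continuous_subspaceT.
    by move=> z _; exists 1.
  apply: has_angle_scale (has_angle_mul (has_angle_conj aT) hC) => z Cz.
  exists 1 => //; rewrite scale1r hU//; last exact: CU.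
  rewrite /hq; move: (unitv _) => [v1 v2].
  rewrite /cmul /conjp /polar /= !mul1r; set c := cos _; set s := sin _.
  have cs : c ^+ 2 + s ^+ 2 = 1 by exact: cos2Dsin2.
  by congr pair; rewrite -[LHS]mul1r -cs; ring.
have csub (c : R * R) : {within circle p r, continuous (fun z => z - c)}.
  by apply: continuous_subspaceT => z; apply: cvg_subr; exact: cvg_id.
apply: has_angle_close (csub _) (csub _) _ aq => z /circle_dot zr.
(* The law of cosines: the right-hand side is positive because [q] lies strictly inside the
   circle. *)
have : 2 * dot (z - p) (z - q) =
    dot (z - p) (z - p) + dot (z - q) (z - q) - dot (q - p) (q - p).
  by rewrite /dot /=; ring.
have : 0 <= dot (z - q) (z - q) by rewrite /dot -!expr2 addr_ge0// sqr_ge0.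
by rewrite zr; lra.
Qed.

(* A circle round [g s] inside the arc would avoid [g s], hence lie in two
   disjoint arcs, on each of which [z - g s] has an angle. *)
Lemma arc_no_nbhs (g : R -> R * R) (s : R) :
  {within `[0, 1], continuous g} -> {in `[0, 1] &, injective g} ->
  `[0, 1]%classic s -> ~ nbhs (g s) (g @` `[0, 1]).
Proof.
move=> cg ig Is /nbhs_ballP[e /= e0 eg].
have r0 : 0 < e / 2 by rewrite divr_gt0.
have Cg : circle (g s) (e / 2) `<=` g @` `[0, 1].
  move=> _ [t _ <-]; apply: eg; rewrite -ball_normE /= opprD addNKr normrN.
  rewrite prod_normE /polar /=.
  rewrite gt_max.
  have le1 (x : R) : `|x| <= 1 -> `|e / 2 * x| < e.
    move=> x1; rewrite normrM (gtr0_norm r0).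
    apply: (@le_lt_trans _ _ (e / 2 * 1)); last by lra.
    by rewrite ler_pM2l.
  by rewrite !le1// ler_norml ?cos_geN1 ?cos_le1 ?sin_geN1 ?sin_le1.
(* Parameters within [d] of [s] land too near [g s] to be on the circle, so the images of
   [[0, s - d]] and [[s + d, 1]] cover it. *)
have [d d0 gd] : exists2 d : R, 0 < d & forall t, `[0, 1]%classic t ->
    `|t - s| < d -> ~ circle (g s) (e / 2) (g t).
  move/subspace_continuousP : (cg) => /(_ _ Is) cgs.
  have /cvgr_lt/(_ ((e / 2) ^+ 2)) :
      (fun t => dot (g t - g s) (g t - g s)) @ within `[0, 1] (nbhs s) -->
      dot (g s - g s) (g s - g s).
    by apply: cvg_dot; apply: cvg_subr; exact: cgs.
  rewrite subrr {1}/dot mul0r addr0 exprn_gt0// => /(_ isT) /nbhs_ballP[d /= d0 dE].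
  exists d => // t It ts /circle_dot E.
  by have := dE t; rewrite /ball/= distrC => /(_ ts It); rewrite E ltxx.
have sub1 : `[0, s - d] `<=` `[0, 1].
  move=> u /=; rewrite !in_itv/= => /andP[-> us]; move: Is.
  by rewrite /= in_itv/= => /andP[_ s1]; rewrite (le_trans us)//; lra.
have sub2 : `[s + d, 1] `<=` `[0, 1].
  move=> u /=; rewrite !in_itv/= => /andP[us ->]; move: Is.
  by rewrite /= in_itv/= => /andP[s1 _]; rewrite (le_trans _ us)//; lra.
apply: (circle_no_angle r0).
apply: (@has_angle_sub _ _ (g @` `[0, s - d] `|` g @` `[s + d, 1])).
  move=> z Cz; have [t It tz] := Cg _ Cz.
  have : d <= `|t - s|.
    by rewrite leNgt; apply/negP => /(gd _ It); apply; rewrite tz.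
  rewrite ler_normr; move: It; rewrite /= in_itv/= => /andP[t0 t1] /orP[dt|dt].
    by right; exists t => //=; rewrite in_itv/= t1 andbT; lra.
  by left; exists t => //=; rewrite in_itv/= t0; lra.
have piece (a b : R) : `[a, b] `<=` `[0, 1] -> ~ `[a, b]%classic s ->
    has_angle (g @` `[a, b]) (fun z => z - g s).
  move=> sub abs; apply: has_angle_arc.
  - exact: continuous_subspaceW cg.
  - by move=> u v /sub Iu /sub Iv; exact: ig.
  - by move=> z; apply: cvg_subr; exact: cvg_id.
  move=> t It; rewrite subr_eq0; apply/eqP => /(ig _ _ (sub _ It) Is) ts.
  by apply: abs; rewrite -ts.
apply: has_angle_glue.
- by apply: closed_image_segment; exact: continuous_subspaceW cg.
- by apply: closed_image_segment; exact: continuous_subspaceW cg.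
- have -> : g @` `[0, s - d] `&` g @` `[s + d, 1] = set0.
    apply/seteqP; split=> // z [[u Iu <-] [v Iv]].
    move=> /(ig _ _ (sub2 _ Iv) (sub1 _ Iu)) vu; move: Iu Iv; rewrite vu /=.
    by rewrite !in_itv/= => /andP[_ ?] /andP[? _]; lra.
  exact: connected0.
- by apply: piece => //=; rewrite in_itv/= => /andP[_]; lra.
- by apply: piece => //=; rewrite in_itv/= => /andP[+ _]; lra.
Qed.

End Linked.

(** * Adding an arc to a compact set *)

Section Arcs.
Context {R : realType}.
Implicit Types (p q x y z : R * R) (A C H K P L S : set (R * R)).

Lemma compact_closed_plane K : compact K -> closed K.
Proof. by apply: compact_closed; exact: norm_hausdorff. Qed.

Lemma is_arc_sym x y A : is_arc x y A -> is_arc y x A.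
Proof.
move=> [g [cg ig g0 g1 ->]].
have rev (t : R) : t \in `[0, 1] -> 1 - t \in `[0, 1].
  by rewrite !in_itv/=; lra.
exists (fun t => g (1 - t)); split.
- have cr : {within `[0, 1], continuous (fun t : R => 1 - t)}.
    by apply: continuous_subspaceT => t; apply: cvgB; [exact: cvg_cst|exact: cvg_id].
  exact: (within_continuous_comp_subset cr rev cg).
- move=> t u /rev It /rev Iu /(ig _ _ It Iu); lra.
- by rewrite subr0.
- by rewrite subrr.
apply/seteqP; split=> _ [t /rev It <-].
  by exists (1 - t) => //; rewrite opprB addrC subrK.
by exists (1 - t).
Qed.

Lemma is_arc_source x y A : is_arc x y A -> A x.
Proof.
by move=> [g [_ _ <- _ ->]]; exists 0 => //=; rewrite in_itv/= lexx ler01.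
Qed.

Lemma is_arc_target x y A : is_arc x y A -> A y.
Proof. by move=> /is_arc_sym/is_arc_source. Qed.

Lemma is_arc_compact x y A : is_arc x y A -> compact A.
Proof.
move=> [g [cg _ _ _ ->]].
by apply: continuous_compact => //; exact: segment_compact.
Qed.

Lemma is_arc_connected x y A : is_arc x y A -> connected A.
Proof.
move=> [g [cg _ _ _ ->]].
by apply: connected_continuous_connected => //; exact: segment_connected.
Qed.

Lemma is_arc_linked x y A p q : is_arc x y A -> ~ A p -> ~ A q -> linked A p q.
Proof. by move=> [g [cg ig _ _ ->]]; exact: linked_arc. Qed.

Lemma is_arc_no_nbhs x y A z : is_arc x y A -> ~ nbhs z A.
Proof.
move=> [g [cg ig _ _ ->]] zA; have [s Is sz] := nbhs_singleton zA.
by apply: (arc_no_nbhs cg ig Is); rewrite sz.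
Qed.

(** For compact [K] and [p] off [K] this is the component of [p] in the complement, in the form to
    which Janiszewski's theorem applies. *)
Definition linked_class K p : set (R * R) := [set q | ~ K q /\ linked K p q].

Lemma linked_class_near K p : compact K -> ~ K p ->
  \forall q \near p, linked_class K p q.
Proof.
move=> cK Kp; near=> q; split; last by near: q; exact: linked_near.
near: q; apply: (@open_nbhs_nbhs _ p (~` K)); split => //.
by apply: closed_openC; exact: compact_closed_plane.
Unshelve. all: by end_near. Qed.

Lemma linked_classS K p q : ~ K p -> linked_class K p q ->
  linked_class K q `<=` linked_class K p.
Proof. by move=> Kp [Kq pq] s [Ks qs]; split=> //; exact: linked_trans pq qs. Qed.

(* If the class missed a neighbourhood of [x], it would be a full component of
   the complement of [H] and the rest of the arc; but a point of the arc close
   to [x] belongs to that component. *)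
Lemma closure_linked_class_source H A x y p z :
  compact H -> is_arc x y A -> H x -> H y ->
  (forall w, H w -> A w -> w = x \/ w = y) ->
  ~ (H `|` A) p -> A z -> ~ H z -> linked H p z ->
  closure (linked_class (H `|` A) p) x.
Proof.
move=> cH aA Hx Hy HA HAp Az Hz pz.
have cA := is_arc_compact aA; have cHA : compact (H `|` A) by exact: compactU.
move: aA (Az) => [g [cg ig g0 g1 AE]]; rewrite {1}AE => -[s Is sz].
apply: contrapT => /existsNP[N' /not_implyP[xN' /set0P/negP/negPn/eqP WN']].
pose N := interior N'.
have WN w : N w -> ~ linked_class (H `|` A) p w.
  move=> /interior_subset Nw Ww.
  by have : (linked_class (H `|` A) p `&` N') w by []; rewrite WN'.
have I0 : `[0, 1]%classic (0 : R) by rewrite /= in_itv/= lexx ler01.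
have I1 : `[0, 1]%classic (1 : R) by rewrite /= in_itv/= lexx ler01.
have [d [d0 d1 gN]] : exists d : R, [/\ 0 < d, d <= 1 &
    forall t, 0 <= t < d -> N (g t)].
  move/subspace_continuousP : (cg) => /(_ _ I0) cg0.
  have /cg0/nbhs_ballP[e /= e0 eN] : nbhs (from_subspace `[0, 1] g 0) N.
    by rewrite /from_subspace g0; exact: nbhs_interior.
  exists (Num.min e 1); rewrite lt_min e0 ltr01 ge_min lexx orbT.
  split=> // t /andP[t0]; rewrite lt_min => /andP[te t1].
  apply: eN; first by rewrite /ball/= sub0r normrN ger0_norm.
  by rewrite in_itv/= t0 ltW.
have inj t u : `[0, 1]%classic t -> `[0, 1]%classic u -> g t = g u -> t = u.
  by move=> It Iu; exact: ig.
have Hg t : 0 < t < 1 -> ~ H (g t).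
  move=> /andP[t0 t1] Hgt; have It : `[0, 1]%classic t by rewrite /= in_itv/= !ltW.
  have Agt : A (g t) by rewrite AE; exists t.
  case: (HA _ Hgt Agt); rewrite -?g0 -?g1 => /inj-/(_ It).
    by move=> /(_ I0) t00; rewrite t00 ltxx in t0.
  by move=> /(_ I1) t11; rewrite t11 ltxx in t1.
(* The arc is cut at [c < d], so that the removed beginning lies in [N]; [g u] is a point of that
   beginning, off the remaining compact set [K]. *)
pose c := d / 2; pose u := d / 4.
have [c0 uc cd c1] : [/\ 0 < c, u < c, c < d & c <= 1].
  by rewrite /u /c; clear -d0 d1; split; lra.
have u01 : 0 < u < 1 by rewrite /u; clear -d0 d1; lra.
have Iu : `[0, 1]%classic u.
  by move/andP: u01 => [? ?]; rewrite /= in_itv/= !ltW.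
have sub : `[c, 1] `<=` `[0, 1].
  by move=> t /=; rewrite !in_itv/= => /andP[/(le_trans (ltW c0))-> ->].
pose B := g @` `[c, 1]; pose K := H `|` B.
have BA : B `<=` A by rewrite AE; exact: image_subset.
have KHA : K `<=` H `|` A by move=> w [|/BA]; [left|right].
have cB : compact B.
  apply: continuous_compact; first exact: continuous_subspaceW cg.
  exact: segment_compact.
have cK : compact K by exact: compactU.
have Bu : ~ B (g u).
  move=> [t Ict] /(inj _ _ (sub _ Ict) Iu) tu.
  by move: Ict; rewrite tu /= in_itv/= leNgt uc.
have Ku : ~ K (g u) by move=> [/(Hg _ u01)|].
have Kp : ~ K p by move=> /KHA.
have pu : linked H p (g u).
  apply: (linked_trans Hz pz).
  have zI : 0 < s < 1.
    move: Is; rewrite /= in_itv/= => /andP[s0 s1].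
    rewrite !lt_neqAle s0 s1 !andbT; apply/andP; split; apply/eqP => E.
      by apply: Hz; rewrite -sz -E g0.
    by apply: Hz; rewrite -sz E g1.
  apply: (@linked_connected _ H (g @` `]0, 1[)) => //.
  - apply: connected_continuous_connected.
      exact/connected_intervalP/interval_is_interval.
    apply: continuous_subspaceW cg => t /=; rewrite !in_itv/=.
    by move=> /andP[? ?]; rewrite !ltW.
  - by move=> _ [t /= + <-]; rewrite in_itv/=; exact: Hg.
  - by exists s => //=; rewrite in_itv.
(* [H] and the remaining arc [B] meet only in [y], and [B] alone links any two points off it, so
   Janiszewski's theorem applies. *)
have pKu : linked K p (g u).
  apply: linked_setU => //; try exact: compact_closed_plane.
    have -> : H `&` B = [set y]; last exact: connected1.
    apply/seteqP; split=> [w [Hw [t Ict tw]]|_ ->]; last first.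
      by split=> //; exists 1 => //=; rewrite in_itv/= lexx andbT.
    have Aw : A w by rewrite AE; exists t => //; exact: sub.
    case: (HA w Hw Aw) => // wx; move: (Ict).
    have -> : t = 0 by apply: inj => //; [exact: sub|rewrite tw g0].
    by rewrite /= in_itv/= leNgt c0.
  apply: linked_arc => //.
  - exact: continuous_subspaceW cg.
  - by move=> t v /sub It /sub Iv; exact: inj.
  - by move=> /BA; move=> Ap; apply: HAp; right.
have [S [Sp SK cS] Su] := linked_component cK Kp Ku pKu.
have WS w : S w -> A w -> N w.
  rewrite AE => Sw [t It tw]; rewrite -tw; apply: gN.
  move: (It); rewrite /= in_itv/= => /andP[t0 t1]; rewrite t0 /=.
  rewrite ltNge; apply/negP => dt; apply: (SK _ Sw); right.
  by exists t => //=; rewrite in_itv/= t1 andbT (le_trans (ltW cd)).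
have Wp : linked_class (H `|` A) p p by split=> //; exact: linked_refl.
have Au : A (g u) by rewrite AE; exists u.
(* If membership in the class is locally constant along [S], it passes from [p] to [g u], which is
   absurd since [g u] is on the arc. At a point of [S] on the arc it is constantly false, as such
   points lie in [N]. *)
suff loc : forall w, S w -> \forall v \near w, S v ->
    (linked_class (H `|` A) p w <-> linked_class (H `|` A) p v).
  have [+ _] := connected_locally_constant cS loc Sp Su Wp.
  by apply; right.
move=> w Sw; have [Aw|Aw] := pselect (A w).
  have : nbhs w N by apply: open_nbhs_nbhs; split; [exact: open_interior|exact: WS].
  by apply: filterS => v Nv _; split=> [/(WN _ (WS _ Sw Aw))|/(WN _ Nv)].
have HAw : ~ (H `|` A) w by move=> [Hw|//]; apply: (SK _ Sw); left.
apply: filterS (linked_class_near cHA HAw) => v wv Sv; split=> Wv.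
  exact: linked_classS Wv _ wv.
case: wv Wv => HAv wv [_ pv]; split=> //.
by apply: linked_trans HAv pv _; exact: linked_sym.
Qed.

(* The piece of the old face to keep is told apart by the closed curve
   [P `|` A]: it must lie on the side of the points of [L] off the curve,
   while both end points of [A] are on the boundary of every piece. *)
Lemma add_arc_closure H A P L x y p0 :
  compact H -> is_arc x y A -> H x -> H y ->
  (forall w, H w -> A w -> w = x \/ w = y) ->
  closed P -> connected P -> P `<=` H -> P x -> P y ->
  (forall v, L v -> (P `|` A) v -> v = x \/ v = y) ->
  (forall v w, L v -> L w -> ~ (P `|` A) v -> ~ (P `|` A) w ->
    linked (P `|` A) v w) ->
  ~ H p0 -> L `<=` closure (linked_class H p0) ->
  exists2 p1, ~ (H `|` A) p1 & L `<=` closure (linked_class (H `|` A) p1).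
Proof.
move=> cH aA Hx Hy HA clP cP PH Px Py LC Llink Hp0 Lp0; set C := P `|` A.
have cA := is_arc_compact aA; have cHA : compact (H `|` A) by exact: compactU.
have cC : compact C.
  apply: compactU => //; exact: subclosed_compact clP cH PH.
have cHC : connected (H `&` C).
  suff -> : H `&` C = P by [].
  apply/seteqP; split=> [w [Hw [//|Aw]]|w Pw].
    by case: (HA _ Hw Aw) => ->.
  by split; [exact: PH|left].
have HCE : H `|` C = H `|` A by rewrite setUA (setUidl PH).
have CHA : C `<=` H `|` A by rewrite -HCE => w; right.
(* If some point of [L] is off the curve, [p1] is taken in the old class close to it, hence on its
   side. Otherwise any point of the old class off [A] serves; one exists because an arc has empty
   interior. *)
have [p1 [Hp1 p01] [Ap1 Lp1]] : exists2 p1, linked_class H p0 p1 &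
    ~ A p1 /\ (forall v, L v -> ~ C v -> linked C v p1).
  have [[v0 [Lv0 Cv0]]|noL] := pselect (exists v, L v /\ ~ C v).
    have [q [Hq [Cq vq]]] := Lp0 _ Lv0 _ (linked_class_near cC Cv0).
    exists q => //; split=> [Aq|v Lv Cv]; first by apply: Cq; right.
    exact: linked_trans Cv0 (Llink _ _ Lv Lv0 Cv Cv0) vq.
  have [q Hq Aq] : exists2 q, linked_class H p0 q & ~ A q.
    apply: contrapT => noq; apply: (@is_arc_no_nbhs _ _ _ p0 aA).
    apply: filterS (linked_class_near cH Hp0) => q Hq.
    by apply: contrapT => Aq; apply: noq; exists q.
  by exists q => //; split=> // v Lv Cv; case: noL; exists v.
have HAp1 : ~ (H `|` A) p1 by case.
have Cp1 : ~ C p1 by move=> /CHA.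
have p1H : linked_class H p0 `<=` linked_class H p1.
  by apply: linked_classS => //; split=> //; exact: linked_sym.
exists p1 => // v Lv; have [Cv|Cv] := pselect (C v); last first.
  move=> N vN; have [q [Hq [[Cq vq] Nq]]] :=
    Lp0 _ Lv _ (filterI (linked_class_near cC Cv) vN).
  exists q; split=> //; split.
    by rewrite -HCE => -[|//]; case: Hq.
  rewrite -HCE; apply: linked_setU => //; try exact: compact_closed_plane.
    by case: (p1H _ Hq).
  apply: (linked_trans Cv _ vq); apply: linked_sym; exact: Lp1 Lv Cv.
(* Now [v] is an end of the arc. If the arc enters the old class, both its ends are in the closure
   of the new one; if not, every point of the old class stays joined to [p1] off the arc. *)
have [[z [Az [Hz p0z]]]|noz] := pselect (exists z, A z /\ linked_class H p0 z).
  have p1z : linked H p1 z by case: (p1H z).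
  case: (LC _ Lv Cv) => ->.
    exact: (closure_linked_class_source cH aA Hx Hy HA HAp1 Az Hz p1z).
  apply: (closure_linked_class_source cH (is_arc_sym aA) Hy Hx _ HAp1 Az Hz p1z).
  by move=> w Hw Aw; case: (HA _ Hw Aw); [right|left].
apply: closure_subset (Lp0 _ Lv) => q /p1H Hq.
have [S [Sp SH cS] Sq] := linked_component cH Hp1 Hq.1 Hq.2.
have SHA : S `<=` ~` (H `|` A).
  move=> w Sw [/(SH _ Sw)//|Aw]; apply: noz; exists w; split=> //; split.
    exact: SH.
  by apply: linked_trans Hp1 p01 _; exact: linked_connected Sp Sw.
by split; [exact: SHA|exact: linked_connected SHA Sp Sq].
Qed.

End Arcs.

(** * Trees and their drawings *)

Lemma linked_set1 (R : realType) (x p q : R * R) :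
  p <> x -> q <> x -> linked [set x] p q.
Proof.
move=> px qx; have x0 : cmul (x - p) (conjp (x - q)) != 0.
  rewrite cmul_eq0 conjp_eq0 !subr_eq0 negb_or.
  by apply/andP; split; apply/eqP => xE; [apply: px|apply: qx].
apply: has_angle_scale (has_angle_cst _ x0) => z ->.
by exists 1; rewrite ?scale1r.
Qed.

Lemma compact_notin (R : realType) (K : set (R * R)) :
  compact K -> exists p, ~ K p.
Proof.
move=> cK; have [r [r0 _ Kr]] := compact_disc_bound 0 0 cK.
exists (0 + polar r 0) => /Kr; rewrite (@circle_dot _ 0 r) ?ltxx//.
by exists 0 => //=; rewrite in_itv/= lexx mulr_ge0// pi_ge0.
Qed.

Section Trees.
Context {V : finType}.
Implicit Types (e t r : rel V) (c p : seq V).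

(** An inner vertex has its predecessor and its successor as distinct neighbours. So a fundamental
    cycle contains no leaf other than the ends of its non-tree edge. *)
Lemma leaf_path_end t x p v : symmetric t -> path t x p -> uniq (x :: p) ->
  v \in x :: p -> leaf t v -> v = x \/ v = last x p.
Proof.
move=> sym_t + + + /cards1P[w tv].
have tvE a : t v a -> a = w.
  by move=> tva; apply/set1P; rewrite -tv inE.
rewrite inE => + + /orP[/eqP->|]; first by left.
move=> + + vp; case/splitPr: vp => p1 p2; rewrite cat_path last_cat /=.
case: p2 => [|b p2]; first by right.
move=> /and4P[_ tav tvb _]; rewrite -cons_uniq -cat_cons cat_uniq => /and3P[_ + _].
move=> /hasP; case; exists (last x p1); last exact: mem_last.
by rewrite (tvE (last x p1)) 1?sym_t// -(tvE b)// !inE eqxx orbT.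
Qed.

Lemma path_fundamental_cycle e t x y p : irreflexive e -> e x y ->
  ~~ t x y -> path t x p -> last x p = y -> uniq (x :: p) ->
  fundamental_cycle t x y (x :: p).
Proof.
move=> irr_e exy txy tp py up; rewrite /fundamental_cycle /graph_cycle up /=.
rewrite rcons_path py /=; apply/and3P; split; last 2 first.
- by apply: sub_path tp => a b tab; apply/orP; left.
- by apply/orP; right; rewrite /same_edge !eqxx orbT.
(* At least three vertices: an empty [p] would make [xy] a loop, and a single step would put [xy] in
   [t]. *)
case: p tp py {up} => [|a [|b p]]//=.
  by move=> _ xy; rewrite xy irr_e in exy.
by rewrite andbT => txa ay; rewrite -ay txa in txy.
Qed.

Lemma tree_path t x y : gconnected t ->
  exists p, [/\ path t x p, last x p = y & uniq (x :: p)].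
Proof.
move=> [_ con]; have {con}/connectP[p tp ->] :=
  con x y (finset.in_setT _) (finset.in_setT _).
have {}tp : path t x p by apply: sub_path tp => a b /= /and3P[].
by case/shortenP: tp => p' tp' up' _; exists p'.
Qed.

(* Two neighbours in [A] of a vertex outside [A] would close a cycle. *)
Lemma acyclic_unique_neighbour t (A : {set V}) a a' b :
  symmetric t -> (forall c, ~~ graph_cycle t c) ->
  {in A &, forall u v, connect (Defs.induced t A) u v} ->
  a \in A -> a' \in A -> b \notin A -> t a b -> t a' b -> a = a'.
Proof.
move=> sym_t acyc conA aA a'A bA tab ta'b; apply/eqP/contraT => aa'.
have /connectP[p tp pE] := conA _ _ aA a'A.
move: pE; case/shortenP: tp => p' tp' up' _ pE.
have pA : all (mem A) (a :: p').
  rewrite /= aA /=; elim: p' a tp' {aA tab aa' up' pE} => //= u p' IH a.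
  by move=> /andP[/and3P[_ -> _] /IH].
have := acyc [:: b, a & p']; rewrite /graph_cycle /= => /negP[].
apply/and3P; split.
- by case: p' {pA tp' up'} pE aa' => // ->; rewrite eqxx.
- move: up' => /= ->; rewrite andbT; apply: contra bA => ba.
  exact: (allP pA).
rewrite sym_t tab rcons_path -pE ta'b andbT.
by apply: sub_path tp' => u v /= /and3P[].
Qed.

Lemma path_exit r (A : {set V}) x p : path r x p -> x \in A ->
  last x p \notin A -> exists a b, [/\ a \in A, b \notin A & r a b].
Proof.
elim: p x => [|y p IH] x /=; first by move=> _ ->.
move=> /andP[rxy rp] xA lA; have [yA|yA] := boolP (y \in A); first exact: IH rp yA lA.
by exists x, y.
Qed.

End Trees.

Section Drawings.
Context {R : realType} {V : finType} (e : rel V).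
Context (pt : V -> R * R) (ed : V -> V -> set (R * R)).
Context (simple_e : simple_graph e) (draw_e : plane_drawing e pt ed).
Implicit Types (r t : rel V) (A : {set V}).

Let irr_e : irreflexive e := proj2 simple_e.

(** Unlike in [drawing_support], vertices outside [A] are not drawn; this serves to grow a tree
    vertex by vertex and to delete a leaf. *)
Definition partial_drawing A r : set (R * R) :=
  pt @` [set` A] `|` [set z | exists u v, r u v /\ ed u v z].

Lemma edge_source u v : e u v -> ed u v (pt u).
Proof. by move=> /(drawing_arc draw_e)/is_arc_source. Qed.

Lemma edge_target u v : e u v -> ed u v (pt v).
Proof. by move=> /(drawing_arc draw_e)/is_arc_target. Qed.

Lemma edges_meet u v u' v' z : e u v -> e u' v' ->
  ~~ same_edge u v u' v' -> ed u v z -> ed u' v' z ->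
  exists w, [/\ z = pt w, w = u \/ w = v & w = u' \/ w = v'].
Proof.
move=> euv euv' ne zuv zuv'.
have [w zw] := drawing_cross draw_e euv euv' ne zuv zuv'.
exists w; split=> //; apply: (drawing_vertex draw_e); rewrite -?zw; eassumption.
Qed.

Lemma compact_partial_drawing A r :
  subrel r e -> compact (partial_drawing A r).
Proof.
move=> re; apply: compactU.
  by apply: finite_compact; apply: finite_image; exact: finite_finset.
have -> : [set z | exists u v, r u v /\ ed u v z] =
    \big[setU/set0]_(w <- enum {: V * V} | r w.1 w.2) ed w.1 w.2.
  rewrite -big_filter -bigcup_seq; apply/seteqP; split=> z /=.
    move=> [u [v [ruv zuv]]]; exists (u, v) => //=.
    by rewrite mem_filter /= ruv mem_enum.
  move=> [[u v]] /=; rewrite mem_filter /= => /andP[ruv _] zuv.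
  by exists u, v.
apply: bigsetU_compact => -[u v] /= /re euv.
exact: is_arc_compact (drawing_arc draw_e euv).
Qed.

(* The tree is built up by pendant arcs, each meeting the previous ones in a
   single point. *)
Lemma tree_linked t p q : spanning_tree e t ->
  ~ drawing_support t pt ed p -> ~ drawing_support t pt ed q ->
  linked (drawing_support t pt ed) p q.
Proof.
move=> [sym_t te con_t acyc] tp tq.
have indt A : subrel (Defs.induced t A) t by move=> u v /and3P[].
have inde A : subrel (Defs.induced t A) e by move=> u v /indt/te.
suff grow n A : #|~: A| = n -> (exists x, x \in A) ->
    {in A &, forall u v, connect (Defs.induced t A) u v} ->
    linked (partial_drawing A (Defs.induced t A)) p q ->
    linked (drawing_support t pt ed) p q.
  have [x0 _] := con_t.1.
  apply: (grow _ [set x0]%SET erefl).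
  - by exists x0; rewrite inE.
  - by move=> u v /set1P-> /set1P->.
  apply: (@linked_sub _ _ [set pt x0]).
    move=> z [[v /= /set1P-> <-]//|[u [v [/and3P[/set1P-> /set1P->]]]]].
    by move=> /te; rewrite irr_e.
  by apply: linked_set1 => E; [apply: tp|apply: tq]; rewrite E; left; exists x0.
elim/ltn_ind: n A => n IH A nA [x0 x0A] conA linkA.
have [AT|[z]] := set_0Vmem (~: A)%SET.
  have TA v : v \in A by rewrite -[A]finset.setCK AT !inE.
  apply: linked_sub linkA => z [[v _ <-]|[u [v [tuv zuv]]]].
    by left; exists v => //=; exact: TA.
  by right; exists u, v; split=> //; apply/and3P; split; rewrite ?TA.
(* A tree path from [A] to a missing vertex leaves [A] through some edge [ab]; that edge is the next
   pendant arc. *)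
rewrite inE => zA; have [s [ts sz _]] := tree_path x0 z con_t.
rewrite -sz in zA; have [a [b [aA bA tab]]] := path_exit ts x0A zA.
have AbA v : v \in (b |: A)%SET -> v = b \/ v \in A by move=> /setU1P.
apply: (IH _ _ (b |: A)%SET erefl).
- rewrite -nA; apply: proper_card; apply/properP; split.
    by apply/fintype.subsetP => u; rewrite !inE negb_or => /andP[].
  by exists b; rewrite !inE ?eqxx.
- by exists b; rewrite setU11.
- have up : subrel (Defs.induced t A) (Defs.induced t (b |: A)%SET).
    by move=> u v /and3P[uA vA tuv]; apply/and3P; split=> //; exact: setU1r.
  have conU u v : u \in A -> v \in A -> connect (Defs.induced t (b |: A)%SET) u v.
    by move=> uA vA; apply: connect_sub (conA _ _ uA vA) => x y /up/connect1.
  have edge_ab : Defs.induced t (b |: A)%SET a b.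
    by apply/and3P; rewrite setU11 setU1r.
  have edge_ba : Defs.induced t (b |: A)%SET b a.
    by apply/and3P; rewrite setU11 setU1r// sym_t.
  move=> u v /AbA[->|uA] /AbA[->|vA]; [exact: connect0| | |exact: conU].
    exact: connect_trans (connect1 edge_ba) (conU _ _ aA vA).
  exact: connect_trans (conU _ _ uA aA) (connect1 edge_ab).
apply: (@linked_sub _ _ (partial_drawing A (Defs.induced t A) `|` ed a b)).
  move=> w [[v /= /AbA[->|vA] <-]|[u [v [/and3P[/AbA uA /AbA vA tuv] wuv]]]].
  - by right; apply: edge_target; exact: te.
  - by left; left; exists v.
  case: uA vA tuv wuv => [->|uA] [->|vA] tuv wuv.
  - by have := te _ _ tuv; rewrite irr_e.
  - right; rewrite (drawing_sym draw_e (te _ _ tuv)) in wuv.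
    rewrite sym_t in tuv.
    by rewrite (acyclic_unique_neighbour sym_t acyc conA aA vA bA tab tuv).
  - right.
    by rewrite (acyclic_unique_neighbour sym_t acyc conA aA uA bA tab tuv).
  by left; right; exists u, v; split=> //; apply/and3P; split.
have eab : e a b by exact: te.
have arc_ab := drawing_arc draw_e eab.
apply: linked_setU => //.
- by apply: compact_closed_plane; apply: compact_partial_drawing.
- by apply: compact_closed_plane; exact: is_arc_compact arc_ab.
- have -> : partial_drawing A (Defs.induced t A) `&` ed a b = [set pt a].
    apply/seteqP; split=> [w [wA wab]|_ ->]; last first.
      by split; [left; exists a|exact: edge_source].
    have [v [-> vA vab]] : exists v, [/\ w = pt v, v \in A & v = a \/ v = b].
      case: wA => [[v /= vA vw]|[u [v [/and3P[uA vA tuv] wuv]]]].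
        exists v; split=> //; apply: (drawing_vertex draw_e eab).
        by rewrite vw.
      have ne : ~~ same_edge u v a b.
        apply/negP => /orP[/andP[_ /eqP vb]|/andP[/eqP ub _]].
          by rewrite -vb vA in bA.
        by rewrite -ub uA in bA.
      have [x [wx xuv xab]] := edges_meet (te _ _ tuv) eab ne wuv wab.
      by exists x; split=> //; case: xuv => ->.
    by case: vab vA => -> // bA'; rewrite bA' in bA.
  exact: connected1.
apply: (is_arc_linked arc_ab) => abp; [apply: tp|apply: tq];
  by right; exists a, b.
Qed.

End Drawings.

(** * Drawn fundamental cycles and the induction on edges *)

Section TutteTrees.
Context {R : realType} {V : finType} (e : rel V).
Context (pt : V -> R * R) (ed : V -> V -> set (R * R)).
Context (simple_e : simple_graph e) (draw_e : plane_drawing e pt ed).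
Implicit Types (r t : rel V) (A : {set V}).

Let sym_e : symmetric e := proj1 simple_e.
Let irr_e : irreflexive e := proj2 simple_e.

Lemma compact_drawing_support r : subrel r e ->
  compact (drawing_support r pt ed).
Proof.
move=> re; have := compact_partial_drawing (A := [set: V]%SET) draw_e re.
suff -> : partial_drawing pt ed [set: V]%SET r = drawing_support r pt ed by [].
rewrite /partial_drawing /drawing_support; congr (_ `|` _).
by apply/seteqP; split=> z [v _ <-]; exists v => //=; rewrite inE.
Qed.

Lemma drawing_support_add_edge r x y : e x y ->
  drawing_support (add_edge r x y) pt ed = drawing_support r pt ed `|` ed x y.
Proof.
move=> exy; apply/seteqP; split=> z.
  case=> [?|[u [v [/orP[ruv|xyuv] zuv]]]]; first by left; left.
    by left; right; exists u, v.
  right; case/orP: xyuv zuv => /andP[/eqP<- /eqP<-]//.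
  by rewrite (drawing_sym draw_e exy).
case=> [[?|[u [v [ruv zuv]]]]|zxy]; [by left| |].
  by right; exists u, v; split=> //; apply/orP; left.
by right; exists x, y; split=> //; apply/orP; right; rewrite /same_edge !eqxx.
Qed.

Fixpoint path_drawing (x : V) (p : seq V) : set (R * R) :=
  if p is y :: p' then ed x y `|` path_drawing y p' else [set pt x].

Lemma path_drawing_vertex x p v : path e x p -> v \in x :: p ->
  path_drawing x p (pt v).
Proof.
elim: p x => [|y p IH] x /=; first by rewrite inE => _ /eqP->.
move=> /andP[exy ep]; rewrite inE => /orP[/eqP->|vp]; last by right; exact: IH.
by left; exact: (edge_source draw_e exy).
Qed.

Lemma path_drawing_compact x p : path e x p -> compact (path_drawing x p).
Proof.
elim: p x => [|y p IH] x /=; first by move=> _; exact: compact_set1.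
move=> /andP[exy ep]; apply: compactU; last exact: IH.
exact: is_arc_compact (drawing_arc draw_e exy).
Qed.

Lemma path_drawing_connected x p : path e x p -> connected (path_drawing x p).
Proof.
elim: p x => [|y p IH] x /=; first by move=> _; exact: connected1.
move=> /andP[exy ep]; apply: connectedU; last exact: IH.
  exists (pt y); split; first exact: (edge_target draw_e exy).
  by apply: path_drawing_vertex ep _; rewrite inE eqxx.
exact: is_arc_connected (drawing_arc draw_e exy).
Qed.

Lemma path_drawing_sub r x p : path r x p ->
  path_drawing x p `<=` drawing_support r pt ed.
Proof.
elim: p x => [|y p IH] x /=; first by move=> _ _ ->; left; exists x.
move=> /andP[rxy rp] z [zxy|]; last exact: IH.
by right; exists x, y.
Qed.

Lemma path_drawing_edge x p z : path e x p -> path_drawing x p z ->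
  z = pt x \/ exists u v, [/\ u \in x :: p, v \in x :: p, e u v & ed u v z].
Proof.
elim: p x => [|y p IH] x /=; first by move=> _ ->; left.
move=> /andP[exy ep] [zxy|/(IH _ ep)[->|[u [v [up vp euv zuv]]]]]; right.
- by exists x, y; rewrite !inE !eqxx orbT.
- exists x, y; rewrite !inE !eqxx orbT; split=> //.
  exact: (edge_target draw_e exy).
by exists u, v; rewrite !(in_cons x) up vp !orbT.
Qed.

Definition cycle_drawing x p : set (R * R) :=
  path_drawing x p `|` ed x (last x p).

Lemma cycle_drawing_compact x p : path e x p -> e x (last x p) ->
  compact (cycle_drawing x p).
Proof.
move=> ep exl; apply: compactU; first exact: path_drawing_compact.
exact: is_arc_compact (drawing_arc draw_e exl).
Qed.

Lemma cycle_drawing_edge x p z : path e x p -> e x (last x p) ->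
  cycle_drawing x p z ->
  exists u v, [/\ u \in x :: p, v \in x :: p, e u v & ed u v z].
Proof.
move=> ep exl; have lp := mem_last x p; have xp := mem_head x p.
have xx := edge_source draw_e exl.
move=> [/(path_drawing_edge ep)[->|//]|zxl]; by exists x, (last x p).
Qed.

Lemma cycle_drawing_vertex x p v : path e x p -> e x (last x p) ->
  cycle_drawing x p (pt v) -> v \in x :: p.
Proof.
move=> ep exl /(cycle_drawing_edge ep exl)[u [w [up wp euw]]].
by move=> /(drawing_vertex draw_e euw)[->|->].
Qed.

(** Each edge with both ends off the cycle is drawn as a connected set missing the drawn cycle.
    Through this lemma the connectedness of the graph minus the cycle puts all its vertices on one
    side. *)
Lemma linked_off_cycle x p v w : path e x p -> e x (last x p) ->
  v \notin x :: p ->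
  connect (Defs.induced e [set u | u \notin x :: p]%SET) v w ->
  linked (cycle_drawing x p) (pt v) (pt w).
Proof.
move=> ep exl vp /connectP[s es ->].
elim: s v vp es => [|u s IH] v vp /=.
  by move=> _; apply: linked_refl => /(cycle_drawing_vertex ep exl); exact/negP.
move=> /andP[/and3P[_ + evu] es]; rewrite inE => up.
apply: (linked_trans _ _ (IH _ up es)).
  by move=> /(cycle_drawing_vertex ep exl); exact/negP.
apply: (@linked_connected _ _ (ed v u)).
- exact: cycle_drawing_compact.
- exact: is_arc_connected (drawing_arc draw_e evu).
- move=> z zvu /(cycle_drawing_edge ep exl)[a [b [ap bp eab zab]]].
  have ne : ~~ same_edge v u a b.
    by apply/negP => /orP[|] /andP[/eqP va _]; rewrite va ?ap ?bp in vp.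
  have [c [_ cvu cab]] := edges_meet draw_e evu eab ne zvu zab.
  have cp : c \in x :: p by case: cab => ->.
  by case: cvu cp => ->; exact/negP.
- exact: (edge_source draw_e evu).
- exact: (edge_target draw_e evu).
Qed.

(** The invariant of the induction: [t] fixes the leaves while [r] grows from [t] to the whole
    graph. The closure is enough, since vertices lie on the drawing and are never interior to a
    class. *)
Definition leaves_on_class t r p : Prop :=
  ~ drawing_support r pt ed p /\
  pt @` [set v | leaf t v] `<=` closure (linked_class (drawing_support r pt ed) p).

(** All points off the tree form one class, so failure at a leaf means a neighbourhood filled by the
    drawn tree. The tree without that leaf is compact and stays away from it, so its single arc
    would fill a neighbourhood. *)
Lemma tree_leaves_on_class t : spanning_tree e t ->
  exists p, leaves_on_class t t p.
Proof.
move=> tree_t; have [sym_t te _ _] := tree_t.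
have [p tp] := compact_notin (compact_drawing_support te).
exists p; split=> // _ [v lv <-] N vN; apply: contrapT => noN.
have {}noN : N `<=` drawing_support t pt ed.
  move=> z Nz; apply: contrapT => tz; apply: noN; exists z; split=> //.
  by split=> //; exact: (tree_linked simple_e draw_e).
move: lv => /cards1P[w tv].
have tvE a : t v a -> a = w.
  by move=> tva; apply/set1P; rewrite -tv inE.
have evw : e v w by apply: te; have := set11 w; rewrite -tv inE.
pose rest : rel V := fun a b => [&& t a b, a != v & b != v].
have reste : subrel rest e by move=> a b /and3P[/te].
pose T := partial_drawing pt ed (~: [set v])%SET rest.
have cT : compact T := compact_partial_drawing draw_e reste.
have Tv : ~ T (pt v).
  move=> [[u /= + /(drawing_inj draw_e) uv]|[a [b [/and3P[tab av bv] vab]]]].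
    by rewrite !inE uv eqxx.
  by case: (drawing_vertex draw_e (te _ _ tab) vab) => E; rewrite E eqxx in av bv.
apply: (is_arc_no_nbhs (drawing_arc draw_e evw) (z := pt v)).
have vT : nbhs (pt v) (~` T).
  apply: open_nbhs_nbhs; split=> //.
  by apply: closed_openC; exact: compact_closed_plane.
apply: filterS (filterI vN vT) => z [/noN tz Tz].
case: tz => [[u _ uz]|[a [b [tab zab]]]].
  have [uv|uv] := eqVneq u v.
    by rewrite -uz uv; exact: (edge_source draw_e evw).
  by case: Tz; left; exists u => //=; rewrite !inE.
have [av|av] := eqVneq a v; first by move: tab zab; rewrite av => /tvE ->.
have [bv|bv] := eqVneq b v.
  move: zab; rewrite (drawing_sym draw_e (te _ _ tab)) bv.
  by move: tab; rewrite bv sym_t => /tvE ->.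
by case: Tz; right; exists a, b; split=> //; rewrite /rest tab av bv.
Qed.

Lemma add_edge_leaves_on_class t r x y :
  fundamental_Tutte_tree e t -> subrel t r -> subrel r e -> e x y ->
  (exists p, leaves_on_class t r p) ->
  exists p, leaves_on_class t (add_edge r x y) p.
Proof.
move=> [[sym_t te con_t acyc] tutte] tr re exy [p0 [rp0 Lp0]].
rewrite /leaves_on_class drawing_support_add_edge//.
(* An edge that is already drawn, in either orientation, changes nothing; past this point [xy] is
   not in [r], hence not in [t]. *)
have [xyr|xyr] := pselect (ed x y `<=` drawing_support r pt ed).
  by exists p0; rewrite setUidl.
have new u v : r u v -> ~~ same_edge u v x y.
  move=> ruv; apply/negP => E; apply: xyr => z zxy; right; exists u, v.
  split=> //; case/orP: E => /andP[/eqP-> /eqP->] //.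
  by rewrite -(drawing_sym draw_e exy).
have txy : ~~ t x y.
  by apply/negP => /tr /new; rewrite /same_edge !eqxx.
have [s [ts sy us]] := tree_path x y con_t.
have es : path e x s by exact: sub_path ts.
have exl : e x (last x s) by rewrite sy.
have CE : path_drawing x s `|` ed x y = cycle_drawing x s.
  by rewrite /cycle_drawing sy.
have [] := @add_arc_closure R (drawing_support r pt ed) (ed x y)
  (path_drawing x s) (pt @` [set v | leaf t v]) (pt x) (pt y) p0; last first.
- by move=> p1 rp1 Lp1; exists p1.
- by [].
- by [].
- move=> _ _ [v lv <-] [w lw <-]; rewrite CE => Cv Cw.
  have nC u : ~ cycle_drawing x s (pt u) -> u \notin x :: s.
    move=> Cu; apply/negP => us'; apply: Cu; left.
    exact: path_drawing_vertex.
  (* The Hamiltonian alternative is contradictory here, as the leaf [v] is off the cycle. *)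
  have [full|[_ con]] := tutte _ _ _ exy txy
    (path_fundamental_cycle irr_e exy txy ts sy us).
    by have := nC _ Cv; rewrite full.
  by apply: linked_off_cycle => //; [exact: nC|apply: con; rewrite inE; exact: nC].
- move=> _ [v lv <-]; rewrite CE => /(cycle_drawing_vertex es exl) vs.
  by case: (leaf_path_end sym_t ts us vs lv) => ->; [left|right; rewrite sy].
- by apply: path_drawing_vertex => //; rewrite -sy mem_last.
- by apply: path_drawing_vertex => //; rewrite mem_head.
- by apply: path_drawing_sub; exact: sub_path ts.
- exact: path_drawing_connected.
- by apply: compact_closed_plane; exact: path_drawing_compact.
- move=> w [[v _ <-]|[u [v [ruv wuv]]]] wxy.
    by case: (drawing_vertex draw_e exy wxy) => ->; [left|right].
  have [a [-> _ axy]] := edges_meet draw_e (re _ _ ruv) exy (new _ _ ruv) wuv wxy.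
  by case: axy => ->; [left|right].
- by left; exists y.
- by left; exists x.
- exact: (drawing_arc draw_e exy).
- exact: compact_drawing_support.
Qed.

Lemma leaves_on_class_full t : fundamental_Tutte_tree e t ->
  exists p, leaves_on_class t e p.
Proof.
move=> tutte; have tree_t := tutte.1; have [_ te _ _] := tree_t.
(* [E] will list all ordered pairs of adjacent vertices, tree edges and both orientations included;
   the repetitions are absorbed by [add_edge_leaves_on_class]. *)
pose grow (E : seq (V * V)) : rel V :=
  foldr (fun w r => add_edge r w.1 w.2) t E.
have growP (E : seq (V * V)) : {in E, forall w, e w.1 w.2} ->
    [/\ subrel t (grow E), subrel (grow E) e &
        exists p, leaves_on_class t (grow E) p].
  elim: E => [|[x y] E IH] eE; first by split=> //; exact: tree_leaves_on_class.
  have exy : e x y by apply: (eE (x, y)); rewrite inE eqxx.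
  have [|tE Ee goodE] := IH; first by move=> w wE; apply: eE; rewrite inE wE orbT.
  split=> /= [u v /tE uv|u v|]; last exact: add_edge_leaves_on_class.
    by apply/orP; left.
  move=> /orP[/Ee//|/orP[]/andP[/eqP<- /eqP<-]//].
  by rewrite sym_e.
have [|tE Ee [p goodp]] := growP [seq w <- enum {: V * V} | e w.1 w.2].
  by move=> w; rewrite mem_filter => /andP[].
exists p; rewrite /leaves_on_class.
suff <- : drawing_support (grow [seq w <- enum {: V * V} | e w.1 w.2]) pt ed =
  drawing_support e pt ed by [].
apply/seteqP; split=> z [zV|[u [v [uv zuv]]]]; try by left.
  by right; exists u, v; split=> //; exact: Ee.
right; exists u, v; split=> //.
have : (u, v) \in [seq w <- enum {: V * V} | e w.1 w.2].
  by rewrite mem_filter /= uv mem_enum.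
elim: [seq w <- _ | _] => //= -[x y] E IH; rewrite inE => /orP[/eqP[-> ->]|/IH uvE].
  by apply/orP; right; rewrite /same_edge !eqxx.
by apply/orP; left.
Qed.

End TutteTrees.

Theorem theorem3 (R : realType) (V : finType) (e t : rel V)
    (simple_e : simple_graph e) (connected_e : gconnected e)
    (planar_e : planar R e) (tree_t : spanning_tree e t)
    (tutte_t : fundamental_Tutte_tree e t) :
  forall (pt : V -> R * R) (ed : V -> V -> set (R * R)),
    plane_drawing e pt ed ->
    exists F : set (R * R), is_face e pt ed F /\
      forall v : V, leaf t v -> boundary F (pt v).
Proof.
move=> pt ed draw_e.
have [p [ep Lp]] := leaves_on_class_full simple_e draw_e tutte_t.
have ce : compact (drawing_support e pt ed).
  exact: (compact_drawing_support draw_e).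
exists (connected_component (~` drawing_support e pt ed) p).
split=> [|v lv]; first by exists p.
split; last first.
  by move=> /interior_subset/connected_component_sub; apply; left; exists v.
apply: closure_subset (Lp _ _); last by exists v.
by move=> q [eq pq]; exact: linked_component.
Qed.
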